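(* The map of graded sets $$\{\mathbf{P}^1,\mathbf{P}^1\}^{\mathrm{N}}=\coprod_{n\ge0}\{\mathbf{P}^1,\mathbf{P}^1\}^{\mathrm{N}}_n\longrightarrow\coprod_{n\ge0}\mathrm{MW}^{\mathrm{s}}_n(k)\times_{k^\times/k^{\times2}}k^\times/k^{\times2n},\qquad\Big[\tfrac{A}{B}\Big]\mapsto\big[\mathrm{B\acute{e}z}(A,B),\ \det\mathrm{B\acute{e}z}(A,B)\big]$$ is a bijection.
   Context: Let $k$ be a field. For $n\ge0$, $\mathscr{U}_n$ is the open subscheme of $\mathbf{P}^{2n+1}=\mathrm{Proj}\,k[a_0,\dots,a_n,b_0,\dots,b_n]$ complementary to the hypersurface $\mathrm{res}_{n,n}(a_nX^n+\dots+a_0,\,b_nX^n+\dots+b_0)=0$. (Unpointed) scheme endomorphisms of $\mathbf{P}^1_k$ correspond to pairs ($n$, element of $\mathscr{U}_n(k)$), i.e. pairs $(A,B)$ of polynomials of degree $\le n$ with non-vanishing resultant up to a common scalar in $k^\times$; unpointed naive homotopies $\mathbf{P}^1\times\mathbf{A}^1\to\mathbf{P}^1$ correspond to elements of $\mathscr{U}_n(k[T])$, with source/target given by $T=0,1$. $\{\mathbf{P}^1,\mathbf{P}^1\}^{\mathrm{N}}$ is the set of endomorphisms modulo the equivalence relation generated by unpointed naive homotopies; it splits by degree $n$. Bézout form: writing $\frac{A(X)B(Y)-A(Y)B(X)}{X-Y}=\sum_{1\le p,q\le n}c_{p,q}X^{p-1}Y^{q-1}$, $\mathrm{B\acute{e}z}(A,B)=[c_{p,q}]$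 (a non-degenerate symmetric matrix, defined up to multiplication by squares of units since $(A,B)$ is defined up to scalar). $\mathrm{MW}^{\mathrm{s}}_n(k)$ is the set of stable isomorphism classes of rank-$n$ non-degenerate symmetric bilinear forms over $k$ ($b,b'$ identified if $b\oplus b''\simeq b'\oplus b''$ for some $b''$); $k^{\times2n}$ is the subgroup of $2n$-th powers; the fibre product is over the discriminant map $\mathrm{MW}^{\mathrm{s}}_n(k)\to k^\times/k^{\times2}$ (determinant mod squares) and the projection $k^\times/k^{\times2n}\to k^\times/k^{\times2}$.
   Formalization: In degree n = 0 the group k^×/k^{×2n} is taken to be trivial, so the degree-0 target is a point; read literally it is k^×, and the map is then not surjective in degree 0 (e.g. k = Q, discriminant 4). *)

(* Defs.v *)
From HB Require Import structures.
From mathcomp Require Import all_boot all_order all_algebra.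
From Stdlib Require Import Relations.
Set Implicit Arguments. Unset Strict Implicit. Unset Printing Implicit Defensive.
Import GRing.Theory.
Local Open Scope ring_scope.

(* Sylvester-type matrix with FORMAL degrees (n, n): rows are the coefficient
   vectors of A, X A, ..., X^(n-1) A, B, X B, ..., X^(n-1) B in the basis
   1, X, ..., X^(2n-1).  Its determinant is res_{n,n}(A,B) up to sign. *)
Definition sylv_nn (R : comUnitRingType) (n : nat) (A B : {poly R})
  : 'M[R]_(n + n) :=
  col_mx (\matrix_(i < n, j < n + n) (A * 'X^i)`_j)
         (\matrix_(i < n, j < n + n) (B * 'X^i)`_j).

Definition res_nn (R : comUnitRingType) (n : nat) (A B : {poly R}) : R :=
  \det (sylv_nn n A B).

Definition unimodular_nn (R : comUnitRingType) (n : nat) (A B : {poly R}) :=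
  exists u v : nat -> R,
    \sum_(i < n.+1) (u i * A`_i + v i * B`_i) = 1.

(* R-points of U_n (R = k or k[T], both with trivial Picard group):
   unimodular (a_0..a_n,b_0..b_n) with res_{n,n} a unit; taken up to R^x. *)
Definition Un_point (R : comUnitRingType) (n : nat) (A B : {poly R}) : Prop :=
  [/\ (size A <= n.+1)%N, (size B <= n.+1)%N, unimodular_nn n A B
    & res_nn n A B \is a GRing.unit].

Definition evT (k : fieldType) (t : k) (H : {poly {poly k}}) : {poly k} :=
  map_poly (fun c : {poly k} => c.[t]) H.

(* one elementary step: rescaling by k^x (same point of P^{2n+1}), or an
   unpointed naive homotopy from its source (T=0) to its target (T=1) *)
Definition naive_step (k : fieldType) (n : nat)
  (P Q : {poly k} * {poly k}) : Prop :=
  (exists c : k, c != 0 /\ Q = (c *: P.1, c *: P.2)) \/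
  (exists H1 H2 : {poly {poly k}}, Un_point n H1 H2 /\
     P = (evT 0 H1, evT 0 H2) /\ Q = (evT 1 H1, evT 1 H2)).

Definition naive_equiv (k : fieldType) (n : nat) :=
  clos_refl_sym_trans _ (@naive_step k n).

(* Bezout form: (A(X)B(Y) - A(Y)B(X)) / (X - Y) = sum c_{p,q} X^(p-1) Y^(q-1);
   outer variable X, inner variable Y. *)
Definition bez_quot (k : fieldType) (A B : {poly k}) : {poly {poly k}} :=
  (A^:P * B%:P - A%:P * B^:P) %/ ('X - ('X)%:P).

Definition Bez (k : fieldType) (n : nat) (A B : {poly k}) : 'M[k]_n :=
  \matrix_(i < n, j < n) ((bez_quot A B)`_i)`_j.

Definition sym_nondeg (k : fieldType) (m : nat) (b : 'M[k]_m) : Prop :=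
  b^T = b /\ b \in unitmx.

Definition form_iso (k : fieldType) (m : nat) (b b' : 'M[k]_m) : Prop :=
  exists P : 'M[k]_m, P \in unitmx /\ P^T *m b *m P = b'.

Definition stably_iso (k : fieldType) (n : nat) (b b' : 'M[k]_n) : Prop :=
  exists (m : nat) (c : 'M[k]_m), sym_nondeg c /\
    form_iso (block_mx b 0 0 c) (block_mx b' 0 0 c).

(* equality in k^x / k^{x 2n}.  CONVENTION: for n = 0 this
   group is taken to be trivial, so that the degree-0 component of the target
   is a point (the only reading in which the statement holds). *)
Definition pow2n_equiv (k : fieldType) (n : nat) (x y : k) : Prop :=
  n = 0%N \/ exists u : k, u != 0 /\ x = y * u ^+ (2 * n).

(* elements (b, d) of MW^s_n(k) x_{k^x/k^x2} k^x/k^x2n (representatives) *)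
Definition fib_elem (k : fieldType) (n : nat) (b : 'M[k]_n) (d : k) : Prop :=
  [/\ sym_nondeg b, d != 0 & exists s : k, s != 0 /\ \det b = d * s ^+ 2].

Definition fib_equiv (k : fieldType) (n : nat)
  (x y : 'M[k]_n * k) : Prop :=
  stably_iso x.1 y.1 /\ pow2n_equiv n x.2 y.2.

Definition bez_map (k : fieldType) (n : nat) (A B : {poly k}) : 'M[k]_n * k :=
  (Bez n A B, \det (Bez n A B)).

(* Main.v *)
(* Invariance.  The Bezout matrix of a homotopy is a symmetric unimodular matrix
   M over k[T], and M(0), M(1) are stably isometric: adding metabolic planes
   lowers the degree of M to 1, and from a linear pencil one splits off planes
   [0 1; 1 s(T)] until it is constant.  No square roots are taken, so this works
   in characteristic 2.

   Injectivity and surjectivity.  The homotopies given by SL_2 make a pair pointed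
   (A monic of degree n, deg B < n).  By Euclid's algorithm and the homotopies
   X^d / (b + T X^(d-1)), a pointed pair is homotopic to a continued fraction
   with linear partial quotients X / u_1, ..., X / u_n, whose Bezout form is
   <u_1, ..., u_n>.  Every path of symmetric 2 x 2 matrices of constant
   determinant lifts to a homotopy of the first two partial quotients, whatever
   the rest; this realizes the binary chain moves with exact determinants, and
   also <a, -c^2/a> ~ <a', -c^2/a'>, which is only a stable isometry in
   characteristic 2.  With cancellation of anisotropic forms these moves connect
   any two stably isometric diagonal forms with the same determinant. *)

Require Import Defs.
From HB Require Import structures.
From mathcomp Require Import all_boot all_order all_algebra.
From mathcomp Require Import ring zify.
From Stdlib Require Import Relations Classical.
Set Implicit Arguments. Unset Strict Implicit. Unset Printing Implicit Defensive.
Import GRing.Theory.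
Local Open Scope ring_scope.


(** * Bezout quotients and resultants *)

(** The group k^x / k^x2n comes from rescaling: a common factor c multiplies the Bezout matrix by
    c^2 and its determinant by c^(2n), whereas along a homotopy the determinant is a unit of k[T],
    hence constant. So the moves on continued fractions keep the product of the u_i exactly, not
    only modulo squares, and a square factor can leave one entry only by passing to others. These
    moves have a single source: a matrix of determinant 1 over k[T][X], with suitable degree bounds,
    sends every pointed pair to a pointed pair, so a path of such matrices is a homotopy whatever
    pair it is applied to. *)

Section BezoutQuotient.
Variable R : idomainType.
Implicit Types A B U V : {poly R}.

(** The formula of [bez_quot] over any domain, since homotopies require it over k[T]. *)
Definition bezq A B : {poly {poly R}} :=
  (A^:P * B%:P - A%:P * B^:P) %/ ('X - ('X)%:P).

(** The numerator has the root X = Y; as the divisor is monic, pseudo-division over a domain is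
    exact. *)
Lemma bqE A B : bezq A B * ('X - ('X)%:P) = A^:P * B%:P - A%:P * B^:P.
Proof.
apply/esym/eqP; rewrite /bezq eqp_div_XsubC dvdp_XsubCl /root !hornerE.
by rewrite -!/(_ \Po 'X) !comp_polyXr subrr.
Qed.

Lemma bezq_unique A B q :
  q * ('X - ('X)%:P) = A^:P * B%:P - A%:P * B^:P -> q = bezq A B.
Proof.
by rewrite -bqE; apply/mulIf/negbT/polyXsubC_eq0.
Qed.

Lemma size_bezq n A B : (size A <= n.+1)%N -> (size B <= n.+1)%N ->
  (size (bezq A B) <= n)%N.
Proof.
move=> sA sB; have [->|q0] := eqVneq (bezq A B) 0; first by rewrite size_poly0.
have: (size (bezq A B * ('X - ('X)%:P))%R <= n.+1)%N.
  rewrite bqE; apply: leq_trans (size_polyD _ _) _; rewrite size_polyN geq_max.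
  rewrite mulrC !mul_polyC; apply/andP; split;
    apply: leq_trans (size_scale_leq _ _) _; by rewrite size_map_polyC.
by rewrite size_mul ?polyXsubC_eq0 // size_XsubC addn2.
Qed.

Lemma bezq_sym A B i j : (bezq A B)`_i`_j = (bezq A B)`_j`_i.
Proof.
suff e : swapXY (bezq A B) = bezq A B by rewrite -coef_swapXY e.
apply: bezq_unique.
apply: (can_inj swapXYK); rewrite rmorphM /= swapXYK !rmorphB !rmorphM /=.
rewrite !swapXY_polyC !swapXY_map_polyC swapXY_X /= map_polyX.
by rewrite -opprB mulrN bqE opprB [A%:P * _]mulrC [_ * B%:P]mulrC.
Qed.

Lemma coef_bezq_ge n A B i j : (size A <= n.+1)%N -> (size B <= n.+1)%N ->
  (n <= i)%N || (n <= j)%N -> (bezq A B)`_i`_j = 0.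
Proof.
move=> sA sB.
have aux h l : (n <= h)%N -> (bezq A B)`_h`_l = 0.
  by move=> le; rewrite [_`_h]nth_default ?coef0 // (leq_trans (size_bezq sA sB)).
by case/orP=> lenh; last rewrite bezq_sym; apply: aux.
Qed.

Lemma bqZ c A B : bezq (c *: A) (c *: B) = (c ^+ 2)%:P%:P * bezq A B.
Proof.
apply/esym/bezq_unique; rewrite -mulrA bqE !map_polyZ /= -!mul_polyC !rmorphM /=.
ring.
Qed.

Definition BezR n A B : 'M[R]_n := \matrix_(i < n, j < n) (bezq A B)`_i`_j.

Lemma tr_BezR n A B : (BezR n A B)^T = BezR n A B.
Proof. by apply/matrixP=> i j; rewrite !mxE bezq_sym. Qed.

End BezoutQuotient.

(** Division is not pushed through [f]; the equation that characterises the quotient is. *)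
Lemma bezq_map (R S : idomainType) (f : {rmorphism R -> S}) (A B : {poly R}) :
  map_poly (map_poly f) (bezq A B) = bezq (map_poly f A) (map_poly f B).
Proof.
have mC (P : {poly R}) : map_poly (map_poly f) P^:P = (map_poly f P)^:P.
  by apply/polyP=> i; rewrite !coef_map /= map_polyC.
apply: bezq_unique; have /(congr1 (map_poly (map_poly f))) := bqE A B.
rewrite rmorphM !rmorphB !rmorphM /= !mC !map_polyC /= map_polyX => <-.
by rewrite map_polyX.
Qed.

Lemma BezR_map (R S : idomainType) (f : {rmorphism R -> S}) n (A B : {poly R}) :
  BezR n (map_poly f A) (map_poly f B) = map_mx f (BezR n A B).
Proof. by apply/matrixP=> i j; rewrite !mxE -bezq_map !coef_map. Qed.

Section Sylvester.
Variable R : idomainType.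
Implicit Types A B U V : {poly R}.

(** Surjectivity of Sylvester's map (U, V) -> U A + V B. It is equivalent to the resultant being a
    unit, and easier to carry through changes of the pair (A, B). *)
Definition spans n A B := forall j, (j < n + n)%N ->
  exists U V, [/\ (size U <= n)%N, (size V <= n)%N & U * A + V * B = 'X^j].

Lemma sylv_mul n A B (u v : 'rV[R]_n) j :
  (row_mx u v *m sylv_nn n A B) 0 j = (rVpoly u * A + rVpoly v * B)`_j.
Proof.
have aux (w : 'rV[R]_n) C :
    (w *m (\matrix_(i < n, j < n + n) (C * 'X^i)`_j)) 0 j = (rVpoly w * C)`_j.
  rewrite mxE [rVpoly w]poly_def mulr_suml coef_sum; apply: eq_bigr => i _.
  by rewrite !mxE -scalerAl coefZ [C * _]mulrC valK.
by rewrite /sylv_nn mul_row_col mxE coefD !aux.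
Qed.

Lemma res_spans n A B : (size A <= n.+1)%N -> (size B <= n.+1)%N ->
  res_nn n A B \is a GRing.unit -> spans n A B.
Proof.
move=> sA sB; rewrite /res_nn -[_ \is a _]/(sylv_nn n A B \in unitmx) => uS j ltj.
pose e : 'rV[R]_(n + n) := delta_mx 0 (Ordinal ltj) *m invmx (sylv_nn n A B).
exists (rVpoly (lsubmx e)), (rVpoly (rsubmx e)); rewrite !size_poly; split=> //.
have sz (u : 'rV[R]_n) (C : {poly R}) :
    (size C <= n.+1)%N -> (size (rVpoly u * C)%R <= n + n)%N.
  move=> sC; apply: leq_trans (size_polyMleq _ _) _.
  rewrite -subn1 leq_subLR add1n -addnS leq_add ?size_poly //.
apply/polyP=> i; case: (ltnP i (n + n)) => [lti|lei]; last first.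
  rewrite coefXn gtn_eqF ?(leq_trans ltj) // nth_default //.
  by rewrite (leq_trans (size_polyD _ _)) // geq_max (leq_trans (sz _ _ _) lei) //
    (leq_trans (sz _ _ _) lei).
rewrite -(sylv_mul A B (lsubmx e) (rsubmx e) (Ordinal lti)) hsubmxK mulmxKV //.
by rewrite mxE eqxx coefXn -val_eqE.
Qed.

Lemma spans_res n A B : spans n A B -> res_nn n A B \is a GRing.unit.
Proof.
move=> sp; rewrite /res_nn -[_ \is a _]/(sylv_nn n A B \in unitmx).
have row_ex (j : 'I_(n + n)) :
    {w : 'rV[R]_(n + n) | w *m sylv_nn n A B = delta_mx 0 j}.
  apply/sig_eqW; have [U [V [sU sV e]]] := sp j (ltn_ord j).
  exists (row_mx (poly_rV U) (poly_rV V)); apply/rowP=> i.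
  by rewrite sylv_mul !poly_rV_K // e mxE eqxx coefXn -val_eqE.
pose W := \matrix_j sval (row_ex j).
suff /mulmx1_unit[] : W *m sylv_nn n A B = 1%:M by [].
by apply/row_matrixP=> j; rewrite row_mul rowK (svalP (row_ex j)) row1.
Qed.

(* Pair the first variable of the Bezout quotient Q with a linear functional l.
   Iterating (X - Y) Q = A(X) B(Y) - A(Y) B(X) gives
   l_X (X^n Q) = Y^n l_X(Q) + B V - A U', where the coefficients of V and U' are
   the values of l on the X^r A and X^r B, which are free when the resultant is
   a unit.  Choosing B V - A U' = Y^(n+j) forces l_X(Q) = - Y^j. *)
Lemma BezR_unit n A B : (size A <= n.+1)%N -> (size B <= n.+1)%N ->
  res_nn n A B \is a GRing.unit -> BezR n A B \in unitmx.
Proof.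
move=> sA sB uS; have sp := res_spans sA sB uS.
rewrite /res_nn -[_ \is a _]/(sylv_nn n A B \in unitmx) in uS.
suff row_ex (j : 'I_n) : {w : 'rV[R]_n | w *m BezR n A B = delta_mx 0 j}.
  pose W := \matrix_j sval (row_ex j).
  suff /mulmx1_unit[] : W *m BezR n A B = 1%:M by [].
  by apply/row_matrixP=> j; rewrite row_mul rowK (svalP (row_ex j)) row1.
apply/sig_eqW; have [|U [V [sU sV eUV]]] := sp (n + j)%N; first by rewrite ltn_add2l.
pose c : 'cV[R]_(n + n) :=
  col_mx (\col_i V`_(rev_ord i)) (\col_i (- U`_(rev_ord i))).
have [w wE] : exists w, sylv_nn n A B *m w = c.
  by exists (invmx (sylv_nn n A B) *m c); rewrite mulKVmx.
pose l (C : {poly R}) := \sum_(i < n + n) w i 0 * C`_i.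
have lAB : (forall r : 'I_n, l (A * 'X^r) = V`_(rev_ord r)) /\
           (forall r : 'I_n, l (B * 'X^r) = - U`_(rev_ord r)).
  move: wE; rewrite /sylv_nn mul_col_mx => /eq_col_mx[eA eB].
  split=> r.
    have /colP/(_ r) := eA; rewrite !mxE => <-.
    by apply: eq_bigr => i _; rewrite mxE mulrC.
  have /colP/(_ r) := eB; rewrite !mxE => <-.
  by apply: eq_bigr => i _; rewrite mxE mulrC.
pose L (P : {poly {poly R}}) := \sum_(i < n + n) (w i 0)%:P * P`_i.
have LD P P' : L (P + P') = L P + L P'.
  by rewrite /L -big_split; apply: eq_bigr => i _; rewrite coefD mulrDr.
have LC (C D : {poly R}) : L (C^:P * D%:P) = (l C)%:P * D.
  rewrite /L /l rmorph_sum mulr_suml; apply: eq_bigr => i _.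
  by rewrite coefMC coef_map /= mulrA -polyCM.
have LZ (D : {poly R}) P : L (P * D%:P) = L P * D.
  by rewrite /L mulr_suml; apply: eq_bigr => i _; rewrite coefMC mulrA.
pose Q := bezq A B; pose g := L Q.
have step s : L (Q * 'X^(s.+1)) =
    L (Q * 'X^s) * 'X + ((l (A * 'X^s))%:P * B - (l (B * 'X^s))%:P * A).
  have -> : Q * 'X^(s.+1) = Q * 'X^s * ('X)%:P +
      ((A * 'X^s)^:P * B%:P + (B * 'X^s)^:P * (- A)%:P).
    rewrite !rmorphM /= !map_polyXn rmorphN /= mulrN.
    transitivity (Q * 'X^s * ('X)%:P + 'X^s * (Q * ('X - ('X)%:P))).
      by rewrite exprS; ring.
    by rewrite bqE; congr (_ + _); ring.
  by rewrite !LD !LC LZ mulrN.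
have main s : (s <= n)%N -> L (Q * 'X^s) = g * 'X^s +
   \sum_(r < s) ((l (A * 'X^r))%:P * B - (l (B * 'X^r))%:P * A) * 'X^(s - r.+1).
  elim: s => [|s IHs] les; first by rewrite big_ord0 !expr0 !mulr1 addr0.
  rewrite step IHs ?(ltnW les) // big_ord_recr /= subnn expr0 mulr1 [RHS]addrA.
  congr (_ + _); rewrite mulrDl; congr (_ + _); first by rewrite exprSr mulrA.
  rewrite mulr_suml; apply: eq_bigr => r _; rewrite -mulrA -exprSr.
  by congr (_ * 'X^_); rewrite -subSn.
have := main n (leqnn n).
have polyE (C : {poly R}) : (size C <= n)%N ->
    \sum_(r < n) (C`_(rev_ord r))%:P * 'X^(n - r.+1) = C.
  move=> sC; rewrite (reindex_inj rev_ord_inj) /=.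
  rewrite -[RHS]coefK (poly_def (size C)) (big_ord_widen _ (fun i => C`_i *: 'X^i) sC).
  rewrite [RHS]big_mkcond /=; apply: eq_bigr => i _.
  rewrite -subSn // subSS subKn ?(ltnW (ltn_ord i)) //.
  rewrite mul_polyC; case: ltnP => // le; by rewrite nth_default // scale0r.
rewrite (eq_bigr (fun r : 'I_n => (V`_(rev_ord r))%:P * 'X^(n - r.+1) * B +
    (U`_(rev_ord r))%:P * 'X^(n - r.+1) * A)); last first.
  by move=> r _; rewrite lAB.1 lAB.2 rmorphN /=; ring.
rewrite big_split /= -!mulr_suml !polyE // [V * B + _]addrC eUV => e.
exists (\row_i (- w (lshift n i) 0)); apply/rowP=> i.
move: e => /(congr1 (fun p : {poly R} => p`_(n + i)%N)).
rewrite coefD coefMXn ltnNge leq_addr /= addKn coefXn eqn_add2l.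
(* Q has degree less than n in Y, so the terms of Y-degree at least n cancel among the others; this
   isolates g. *)
have -> : (L (Q * 'X^n))`_(n + i) = 0.
  rewrite /L coef_sum big1 // => h _; rewrite coefCM coefMXn.
  case: ltnP => _; first by rewrite coef0 mulr0.
  by rewrite (@coef_bezq_ge _ n) ?mulr0 // leq_addr orbT.
have -> : g`_i = - (\row_h (- w (lshift n h) 0) *m BezR n A B) 0 i.
  rewrite /g /L coef_sum big_split_ord /= [X in _ + X]big1 ?addr0 => [|h _].
    rewrite mxE -sumrN; apply: eq_bigr => h _.
    by rewrite !mxE coefCM mulNr opprK.
  by rewrite coefCM (@coef_bezq_ge _ n) ?leq_addr // mulr0.
by move/esym/eqP; rewrite addrC subr_eq0 => /eqP <-; rewrite mxE eqxx -val_eqE.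
Qed.
End Sylvester.

(** * Congruence and stable congruence *)

Section Congruence.
Variable R : comUnitRingType.

Definition dsum m n (b : 'M[R]_m) (c : 'M[R]_n) : 'M[R]_(m + n) :=
  block_mx b 0 0 c.

(* Heterogeneous in the size, so that reassociating block sums needs no casts. *)
Definition cong m n (b : 'M[R]_m) (b' : 'M[R]_n) :=
  exists (P : 'M[R]_(m, n)) (Q : 'M[R]_(n, m)),
    [/\ P *m Q = 1%:M, Q *m P = 1%:M & P^T *m b *m P = b'].

Lemma cong_refl m (b : 'M[R]_m) : cong b b.
Proof. by exists 1%:M, 1%:M; rewrite trmx1 !mul1mx mulmx1. Qed.

Lemma cong_sym m n (b : 'M[R]_m) (b' : 'M[R]_n) : cong b b' -> cong b' b.
Proof.
case=> P [Q [PQ QP <-]]; exists Q, P; split=> //.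
by rewrite !mulmxA -trmx_mul PQ trmx1 mul1mx -mulmxA PQ mulmx1.
Qed.

Lemma cong_trans m n p (a : 'M[R]_m) (b : 'M[R]_n) (c : 'M[R]_p) :
  cong a b -> cong b c -> cong a c.
Proof.
case=> P [Q [PQ QP <-]] [P' [Q' [PQ' QP' <-]]]; exists (P *m P'), (Q' *m Q).
split; last by rewrite trmx_mul !mulmxA.
  by rewrite mulmxA -(mulmxA P) PQ' mulmx1.
by rewrite mulmxA -(mulmxA Q') QP mulmx1.
Qed.

Lemma cong_dsum m n m' n' (a : 'M[R]_m) (b : 'M[R]_n) (a' : 'M[R]_m')
    (b' : 'M[R]_n') :
  cong a a' -> cong b b' -> cong (dsum a b) (dsum a' b').
Proof.
case=> P [Q [PQ QP <-]] [P' [Q' [PQ' QP' <-]]].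
exists (block_mx P 0 0 P'), (block_mx Q 0 0 Q').
rewrite /dsum tr_block_mx !mulmx_block !trmx0 !(mul0mx, mulmx0, addr0, add0r).
by rewrite PQ QP PQ' QP' -!scalar_mx_block.
Qed.

Lemma cong_cast m n (e : m = n) (b : 'M[R]_m) : cong (castmx (e, e) b) b.
Proof. by case: n / e; rewrite castmx_id; apply: cong_refl. Qed.

Lemma cong_dsumA m n p (a : 'M[R]_m) (b : 'M[R]_n) (c : 'M[R]_p) :
  cong (dsum a (dsum b c)) (dsum (dsum a b) c).
Proof.
have := @block_mxA _ _ _ _ _ _ _ a 0 0 0 b 0 0 0 c; rewrite /= !row_mx0 !col_mx0.
rewrite /dsum => ->; exact: cong_cast.
Qed.

Lemma cong_dsumC m n (a : 'M[R]_m) (b : 'M[R]_n) : cong (dsum a b) (dsum b a).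
Proof.
exists (block_mx 0 1%:M 1%:M 0), (block_mx 0 1%:M 1%:M 0).
rewrite /dsum tr_block_mx !mulmx_block !trmx0 !trmx1.
by rewrite !(mul0mx, mulmx0, addr0, add0r, mul1mx, mulmx1) -!scalar_mx_block.
Qed.

Lemma cong_size0 (a : 'M[R]_0) (b : 'M[R]_0) : cong a b.
Proof. by rewrite (flatmx0 a) (flatmx0 b); apply: cong_refl. Qed.

Definition symnd m (b : 'M[R]_m) := b^T = b /\ b \in unitmx.

Lemma det_dsum m n (b : 'M[R]_m) (c : 'M[R]_n) : \det (dsum b c) = \det b * \det c.
Proof. exact: det_ublock. Qed.

Lemma unit_dsum m n (b : 'M[R]_m) (c : 'M[R]_n) :
  (dsum b c \in unitmx) = (b \in unitmx) && (c \in unitmx).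
Proof. by rewrite !unitmxE det_dsum unitrM. Qed.

Lemma symnd_dsum m n (b : 'M[R]_m) (c : 'M[R]_n) : symnd (dsum b c) <-> symnd b /\ symnd c.
Proof.
rewrite /symnd unit_dsum /dsum tr_block_mx !trmx0; split.
  by case=> /eq_block_mx[-> _ _ ->] /andP[-> ->].
by case=> -[-> ->] [-> ->].
Qed.

Lemma cong_unit n (b P : 'M[R]_n) : P \in unitmx -> cong b (P^T *m b *m P).
Proof. by move=> uP; exists P, (invmx P); rewrite mulmxV ?mulVmx. Qed.

Lemma cong_of_eq n (b b' P : 'M[R]_n) :
  b' \in unitmx -> P^T *m b *m P = b' -> cong b b'.
Proof.
move=> ub' e; rewrite -e; apply: cong_unit.
by move: ub'; rewrite -e !unitmx_mul => /andP[].
Qed.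

Lemma symnd_cong m n (b : 'M[R]_m) (b' : 'M[R]_n) : cong b b' -> symnd b -> symnd b'.
Proof.
case=> P [Q [PQ QP <-]] [sb ub]; split; first by rewrite !trmx_mul trmxK sb mulmxA.
suff /mulmx1_unit[] : (P^T *m b *m P) *m (Q *m invmx b *m Q^T) = 1%:M by [].
rewrite !mulmxA -(mulmxA _ P) PQ mulmx1 -(mulmxA _ b) mulmxV // mulmx1.
by rewrite -trmx_mul QP trmx1.
Qed.

Lemma cong_schur m n (a : 'M[R]_m) (r : 'M[R]_(m, n)) (d : 'M[R]_n) : symnd a ->
  cong (block_mx a r r^T d) (dsum a (d - r^T *m invmx a *m r)).
Proof.
case=> sa ua; pose x := invmx a *m r.
have -> : dsum a (d - r^T *m invmx a *m r) =
   (block_mx 1%:M (- x) 0 1%:M)^T *m block_mx a r r^T d *m block_mx 1%:M (- x) 0 1%:M.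
  rewrite tr_block_mx !mulmx_block !trmx1 trmx0.
  have -> : (- x)^T = - (r^T *m invmx a) by rewrite linearN /= trmx_mul trmx_inv sa.
  rewrite !(mul0mx, mulmx0, addr0, add0r, mul1mx, mulmx1) !mulNmx !mulmxN.
  rewrite /x -!(mulmxA _ (invmx a) a) mulVmx // mulmx1 !addNr mul0mx oppr0 add0r.
  by rewrite mulmxA mulmxV // mul1mx addNr [_ + d]addrC.
by apply: cong_unit; rewrite unitmxE det_ublock !det1 mulr1 unitr1.
Qed.

Definition metab n (s : 'M[R]_n) : 'M[R]_(n + n) := block_mx 0 1%:M 1%:M s.

Lemma symnd_metab n (s : 'M[R]_n) : s^T = s -> symnd (metab s).
Proof.
move=> ss; split; first by rewrite /metab tr_block_mx ss trmx1 trmx0.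
suff /mulmx1_unit[] : metab s *m block_mx (- s) 1%:M 1%:M 0 = 1%:M by [].
rewrite /metab mulmx_block !(mul0mx, mulmx0, addr0, add0r, mul1mx, mulmx1).
by rewrite addNr -scalar_mx_block.
Qed.

(* (e, f) and (e', f') being the two given bases, the new basis is
   e, f + f' + s (e' - e), e' - e, f' . *)
Lemma cong_metab n (s : 'M[R]_n) : s^T = s ->
  cong (dsum (metab s) (metab (- s))) (dsum (metab (0 : 'M[R]_n)) (metab (- s))).
Proof.
move=> ss; pose I : 'M[R]_n := 1%:M; pose O : 'M[R]_n := 0.
pose P := block_mx (block_mx I (- s) O I) (block_mx (- I) O O O)
                   (block_mx O s O I) (block_mx I O O I).
apply: (@cong_of_eq _ _ _ P).
  rewrite unit_dsum; apply/andP; split; apply: (symnd_metab _).2; first by rewrite trmx0.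
  by rewrite linearN /= ss.
rewrite /P /I /O /dsum /metab !(tr_block_mx, mulmx_block, add_block_mx, trmx0, trmx1).
have -> : (- s)^T = - s by rewrite linearN /= ss.
have -> : (- 1%:M : 'M[R]_n)^T = - 1%:M by rewrite linearN /= trmx1.
rewrite ss !(mul0mx, mulmx0, addr0, add0r, mul1mx, mulmx1).
rewrite !(addNr, subrr, mulmx_block, add_block_mx).
rewrite !(mulNmx, mulmxN, mul1mx, mulmx1, mul0mx, mulmx0, oppr0, addr0, add0r, opprK).
by rewrite !(addNr, subrr, block_mx0).
Qed.

(** With the two halves of the basis exchanged, s becomes the pivot of a Schur complement; what
    remains is - s^-1, congruent to - s. *)
Lemma cong_metab_dsum n (s : 'M[R]_n) : symnd s -> cong (metab s) (dsum s (- s)).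
Proof.
move=> sys; have [ss us] := sys.
apply: (@cong_trans _ _ _ _ (block_mx s 1%:M (1%:M : 'M_n)^T 0)).
  apply: (@cong_of_eq _ _ _ (block_mx 0 1%:M 1%:M 0)); last first.
    rewrite /metab tr_block_mx !mulmx_block !trmx0 !trmx1.
    by rewrite !(mul0mx, mulmx0, addr0, add0r, mul1mx, mulmx1).
  suff /mulmx1_unit[] : block_mx s 1%:M (1%:M : 'M_n)^T 0 *m
      block_mx 0 1%:M 1%:M (- s) = 1%:M by [].
  rewrite mulmx_block trmx1 !(mul0mx, mulmx0, addr0, add0r, mul1mx, mulmx1).
  by rewrite subrr -scalar_mx_block.
apply: cong_trans (cong_schur _ _ sys) _; apply: cong_dsum; first exact: cong_refl.
rewrite trmx1 mul1mx mulmx1 sub0r.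
apply: (@cong_of_eq _ _ _ s); first by rewrite -scaleN1r unitmxZ ?unitrN1.
by rewrite ss mulmxN mulmxV // mulNmx mul1mx.
Qed.

Lemma cong_dsumAC m n p (a : 'M[R]_m) (b : 'M[R]_n) (c : 'M[R]_p) :
  cong (dsum (dsum a b) c) (dsum (dsum a c) b).
Proof.
apply: cong_trans (cong_sym (cong_dsumA _ _ _)) _.
apply: cong_trans (cong_dsumA _ _ _).
by apply: cong_dsum (cong_refl _) (cong_dsumC _ _).
Qed.

Definition stcong m n (b : 'M[R]_m) (b' : 'M[R]_n) :=
  exists p (c : 'M[R]_p), symnd c /\ cong (dsum b c) (dsum b' c).

Lemma cong_stcong m n (b : 'M[R]_m) (b' : 'M[R]_n) : cong b b' -> stcong b b'.
Proof.
move=> bb'; exists 0, 1%:M; split; first by split; rewrite ?trmx1 ?unitmx1.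
exact: cong_dsum (cong_refl _).
Qed.

Lemma stcong_refl m (b : 'M[R]_m) : stcong b b.
Proof. exact: cong_stcong (cong_refl _). Qed.

Lemma stcong_sym m n (b : 'M[R]_m) (b' : 'M[R]_n) : stcong b b' -> stcong b' b.
Proof. by case=> p [c [sc h]]; exists p, c; split=> //; apply: cong_sym. Qed.

Lemma stcong_trans m n p (a : 'M[R]_m) (b : 'M[R]_n) (c : 'M[R]_p) :
  stcong a b -> stcong b c -> stcong a c.
Proof.
case=> q [d [sd h]] [q' [d' [sd' h']]]; exists (q + q')%N, (dsum d d').
split; first exact/symnd_dsum.
apply: cong_trans (cong_dsumA _ _ _) _.
apply: cong_trans (cong_dsum h (cong_refl _)) _.
apply: cong_trans (cong_dsumAC _ _ _) _.
apply: cong_trans (cong_dsum h' (cong_refl _)) _.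
apply: cong_trans (cong_dsumAC _ _ _) _.
exact: cong_sym (cong_dsumA _ _ _).
Qed.

Lemma stcong_dsuml m n p (a : 'M[R]_m) (a' : 'M[R]_n) (b : 'M[R]_p) :
  stcong a a' -> stcong (dsum a b) (dsum a' b).
Proof.
case=> q [c [sc h]]; exists q, c; split=> //.
apply: cong_trans (cong_dsumAC _ _ _) _.
by apply: cong_trans (cong_dsumAC _ _ _); apply: cong_dsum h (cong_refl _).
Qed.

Lemma stcong_dsum m n m' n' (a : 'M[R]_m) (b : 'M[R]_n) (a' : 'M[R]_m')
    (b' : 'M[R]_n') :
  stcong a a' -> stcong b b' -> stcong (dsum a b) (dsum a' b').
Proof.
move=> ha hb; apply: stcong_trans (stcong_dsuml b ha) _.
apply: stcong_trans (cong_stcong (cong_dsumC _ _)) _.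
by apply: stcong_trans (cong_stcong (cong_dsumC _ _)); apply: stcong_dsuml.
Qed.

(** Cancellation is built into stable congruence: h joins the auxiliary form. *)
Lemma stcong_cancel m m' n n' (a : 'M[R]_m) (a' : 'M[R]_m') (h : 'M[R]_n)
    (h' : 'M[R]_n') :
  symnd h -> stcong h h' -> stcong (dsum a h) (dsum a' h') -> stcong a a'.
Proof.
move=> sh hh' /stcong_trans /(_ (stcong_dsum (stcong_refl a') (stcong_sym hh'))).
case=> q [c [sc e]]; exists (n + q)%N, (dsum h c); split; first exact/symnd_dsum.
apply: cong_trans (cong_dsumA _ _ _) _.
exact: cong_trans e (cong_sym (cong_dsumA _ _ _)).
Qed.

(** In characteristic 2 [metab s] need not be congruent to [metab 0]; adding [metab (- s)] erases
    the difference. *)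
Lemma stcong_metab0 n (s : 'M[R]_n) : s^T = s -> stcong (metab s) (metab (0 : 'M_n)).
Proof.
move=> ss; exists (n + n)%N, (metab (- s)); split; last exact: cong_metab.
by apply: symnd_metab; rewrite linearN /= ss.
Qed.

Lemma stcong_metab n (s s' : 'M[R]_n) : s^T = s -> s'^T = s' ->
  stcong (metab s) (metab s').
Proof.
by move=> ss ss'; apply: stcong_trans (stcong_metab0 ss) (stcong_sym (stcong_metab0 ss')).
Qed.

(* b v = w, v^T w = 0 read in a basis starting with v and dual to w *)
Definition hsplit m (x : 'M[R]_(1 + m)) : 'M[R]_(1 + (1 + m)) :=
  block_mx 0 (row_mx 1%:M 0) (col_mx 1%:M 0) x.

(** The Schur correction vanishes: the coupling with the rest involves only the second vector of the
    plane, and the inverse of [metab s] is zero in that corner. *)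
Lemma cong_hsplit m (x : 'M[R]_(1 + m)) : x^T = x ->
  cong (hsplit x) (dsum (metab (ulsubmx x)) (drsubmx x)).
Proof.
move=> sx; set s := ulsubmx x; set y := drsubmx x; set q := ursubmx x.
have xE : x = block_mx s q q^T y by rewrite trmx_ursub sx submxK.
have ss : s^T = s by rewrite /s trmx_ulsub sx.
have sm := symnd_metab ss.
pose r : 'M[R]_(1 + 1, m) := col_mx 0 q.
apply: (@cong_trans _ _ _ _ (block_mx (metab s) r r^T y)).
  have := @block_mxA _ _ _ _ _ _ _ 0 1%:M 0 1%:M s q 0 q^T y.
  rewrite /= -xE => e; rewrite /hsplit e /metab /r tr_col_mx trmx0.
  exact: cong_cast.
apply: cong_trans (cong_schur _ _ sm) _.
suff -> : r^T *m invmx (metab s) *m r = 0 by rewrite subr0; apply: cong_refl.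
have -> : invmx (metab s) = block_mx (- s) 1%:M 1%:M 0.
  apply: (can_inj (mulKmx sm.2)); rewrite mulmxV ?sm.2 // /metab mulmx_block.
  by rewrite !(mul0mx, mulmx0, addr0, add0r, mul1mx, mulmx1) addNr -scalar_mx_block.
rewrite /r tr_col_mx trmx0 mul_row_block mul_row_col.
by rewrite !(mul0mx, mulmx0, addr0, add0r, mul1mx, mulmx1).
Qed.

Lemma sy1 m : symnd (1%:M : 'M[R]_m).
Proof. by split; rewrite ?trmx1 ?unitmx1. Qed.
End Congruence.

Lemma cong_map (R S : comUnitRingType) (f : {rmorphism R -> S}) m n
    (b : 'M[R]_m) (b' : 'M[R]_n) : cong b b' -> cong (map_mx f b) (map_mx f b').
Proof.
case=> P [Q [PQ QP <-]]; exists (map_mx f P), (map_mx f Q).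
by rewrite !map_mxM map_trmx -!map_mxM PQ QP !map_mx1.
Qed.

(** * Splitting off a plane at an isotropic vector *)

Section SplitPlane.
Variable k : fieldType.

Lemma nz_col_unit n (v : 'cV[k]_(1 + n)) : v != 0 ->
  exists2 P : 'M[k]_(1 + n), P \in unitmx & P *m col_mx 1%:M 0 = v.
Proof.
move=> v0; have rv : \rank v = 1%N.
  by apply/eqP; rewrite eqn_leq rank_leq_col lt0n mxrank_eq0.
exists (row_ebase v 0 0 *: col_ebase v).
  rewrite unitmxZ ?col_ebase_unit //.
  by have := row_ebase_unit v; rewrite unitmxE {1}[row_ebase v]mx11_scalar det_scalar1.
rewrite -{3}[v]mulmx_ebase rv pid_mx_col {2}[row_ebase v]mx11_scalar.
by rewrite mul_mx_scalar scalemxAl.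
Qed.

(** Once v is the first basis vector, v^T w = 0 says that w has no first dual coordinate. The other
    basis vectors can then be changed, v staying fixed, until w is the second dual vector. *)
Lemma isotropic_basis n (v w : 'cV[k]_n) : v != 0 -> w != 0 -> v^T *m w = 0 ->
  exists m (P : 'M[k]_(n, 1 + (1 + m))) Q, [/\ P *m Q = 1%:M, Q *m P = 1%:M,
    P *m col_mx 1%:M 0 = v & P^T *m w = col_mx 0 (col_mx 1%:M 0)].
Proof.
case: n v w => [|n] v w; first by rewrite (flatmx0 v) eqxx.
move=> v0 w0 vw; have [P uP Pe] := nz_col_unit v0.
pose w1 : 'cV[k]_(1 + n) := P^T *m w.
have uw1 : usubmx w1 = 0.
  rewrite -vw -Pe trmx_mul -mulmxA -/w1 tr_col_mx trmx1 trmx0 -{2}[w1]vsubmxK.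
  by rewrite mul_row_col mul1mx mul0mx addr0.
have dw1 : dsubmx w1 != 0.
  apply: contraNneq w0 => dw0; have: w1 = 0 by rewrite -[w1]vsubmxK uw1 dw0 col_mx0.
  move/(congr1 (mulmx (invmx P^T))); rewrite mulKmx ?unitmx_tr // mulmx0.
  by move=> ->.
have w1E : P^T *m w = w1 by [].
case: n v w v0 w0 vw P uP Pe w1 uw1 dw1 w1E => [|m] v w v0 w0 vw P uP Pe w1 uw1 dw1 w1E.
  by rewrite (flatmx0 (dsubmx w1)) eqxx in dw1.
have [C uC Ce] := nz_col_unit dw1.
(* Linear forms transform contragrediently, hence the inverse transpose. *)
pose P2 : 'M[k]_(1 + (1 + m)) := block_mx 1%:M 0 0 (invmx C)^T.
have uP2 : P2 \in unitmx by rewrite unitmxE det_ublock det1 mul1r det_tr -unitmxE unitmx_inv.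
exists m, (P *m P2), (invmx (P *m P2)).
have uPP2 : P *m P2 \in unitmx by rewrite unitmx_mul uP.
rewrite mulmxV // mulVmx //; split=> //.
  by rewrite -mulmxA mul_block_col !mulmx0 mulmx1 mul0mx !addr0.
rewrite trmx_mul -mulmxA w1E -[w1]vsubmxK uw1 tr_block_mx !trmx0 trmxK trmx1.
by rewrite mul_block_col !mulmx0 !mul0mx addr0 add0r -Ce mulKmx.
Qed.

Lemma first_col_block m (X : 'M[k]_(1 + m)) (y : 'cV[k]_m) : X^T = X ->
  X *m col_mx 1%:M 0 = col_mx 0 y -> X = block_mx 0 y^T y (drsubmx X).
Proof.
move=> sX; rewrite -{1}[X]submxK mul_block_col !mulmx1 !mulmx0 !addr0.
by case/eq_col_mx=> ul dl; rewrite -{1}[X]submxK ul dl -{2}dl trmx_dlsub sX.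
Qed.

(** [isotropic_basis] with w = b v. As c v = 0, the same basis empties the first row and column of
    c, so a whole pencil is split at once. *)
Lemma isotropic_split n (b c : 'M[k]_n) (v : 'cV[k]_n) : symnd b -> c^T = c ->
  v != 0 -> c *m v = 0 -> v^T *m b *m v = 0 ->
  exists m (P : 'M[k]_(n, 1 + (1 + m))) Q x y,
    [/\ P *m Q = 1%:M, Q *m P = 1%:M, P^T *m b *m P = hsplit x,
        P^T *m c *m P = block_mx 0 0 0 y & x^T = x /\ y^T = y].
Proof.
move=> [sb ub] sc v0 cv vbv.
have bv0 : b *m v != 0.
  by apply: contraNneq v0 => bv; rewrite -(mulKmx ub v) bv mulmx0.
have [|m [P [Q [PQ QP Pe Pw]]]] := isotropic_basis v0 bv0; first by rewrite mulmxA.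
have sP d : d^T = d -> (P^T *m d *m P)^T = P^T *m d *m P.
  by move=> sd; rewrite !trmx_mul trmxK sd mulmxA.
have eb : P^T *m b *m P = hsplit (drsubmx (P^T *m b *m P)).
  rewrite /hsplit -[row_mx 1%:M 0]trmxK tr_row_mx trmx1 trmx0.
  by apply: first_col_block; [exact: sP | rewrite -!mulmxA Pe].
have ec : P^T *m c *m P = block_mx 0 0 0 (drsubmx (P^T *m c *m P)).
  rewrite -[X in block_mx _ X]trmx0; apply: first_col_block; first exact: sP.
  by rewrite -!mulmxA Pe cv mulmx0 col_mx0.
exists m, P, Q, (drsubmx (P^T *m b *m P)), (drsubmx (P^T *m c *m P)).
by split=> //; rewrite !trmx_drsub !sP.
Qed.
End SplitPlane.

(** * Homotopy invariance of symmetric bilinear forms *)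

Section HomotopyInvariance.
Variable k : fieldType.

Definition evmx (t : k) m n (M : 'M[{poly k}]_(m, n)) : 'M[k]_(m, n) :=
  map_mx (horner_eval t) M.

Definition coefmx i m n (M : 'M[{poly k}]_(m, n)) : 'M[k]_(m, n) :=
  \matrix_(a, b) (M a b)`_i.

Definition cstmx m n (M : 'M[k]_(m, n)) : 'M[{poly k}]_(m, n) := map_mx polyC M.

Definition pencil n (b c : 'M[k]_n) : 'M[{poly k}]_n := cstmx b + 'X *: cstmx c.

Lemma evmx_pencil t n (b c : 'M[k]_n) : evmx t (pencil b c) = b + t *: c.
Proof. by apply/matrixP=> i j; rewrite !mxE /horner_eval !hornerE. Qed.

Lemma symnd_pencil n (b c : 'M[k]_n) : b^T = b -> c^T = c -> 
  (pencil b c)^T = pencil b c.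
Proof. by move=> sb sc; rewrite /pencil /cstmx linearD linearZ /= !map_trmx sb sc. Qed.

Lemma coefmxM_cst i m n p (A : 'M[k]_(m, n)) (C : 'M_(n, p)) :
  coefmx i (cstmx A *m C) = A *m coefmx i C.
Proof.
apply/matrixP=> a b; rewrite !mxE coef_sum; apply: eq_bigr => j _.
by rewrite !mxE coefCM.
Qed.

Lemma coefmxX i m n (C : 'M_(m, n)) :
  coefmx i ('X *: C) = if i is j.+1 then coefmx j C else 0.
Proof. by case: i => [|i]; apply/matrixP=> a b; rewrite !mxE coefXM. Qed.

Lemma coefmxD i m n (C D : 'M_(m, n)) : coefmx i (C + D) = coefmx i C + coefmx i D.
Proof. by apply/matrixP=> a b; rewrite !mxE coefD. Qed.

Lemma coefmx_cst i m n (A : 'M[k]_(m, n)) :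
  coefmx i (cstmx A) = if i is 0 then A else 0.
Proof. by case: i => [|i]; apply/matrixP=> a b; rewrite !mxE coefC. Qed.

Lemma coefmx_large m n (C : 'M[{poly k}]_(m, n)) : exists N, coefmx N C = 0.
Proof.
exists (\max_a \max_b size (C a b)); apply/matrixP=> a b; rewrite !mxE.
apply: nth_default; apply: leq_trans (leq_bigmax a).
exact: (leq_bigmax (F := fun b => size (C a b)) b).
Qed.

(* The top nonzero coefficient C_r of the inverse of the pencil b + T c has
   columns v with c v = 0 and v^T b v = 0. *)
Lemma pencil_isotropic n (b c : 'M[k]_n) : symnd b -> c^T = c -> c != 0 ->
  pencil b c \in unitmx ->
  exists v : 'cV[k]_n, [/\ v != 0, c *m v = 0 & v^T *m b *m v = 0].
Proof.
move=> [sb ub] sc c0 up; pose C := invmx (pencil b c).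
have pC : pencil b c *m C = 1%:M by rewrite mulmxV.
have sC : C^T = C by rewrite trmx_inv symnd_pencil.
have eC i : b *m coefmx i C + (if i is j.+1 then c *m coefmx j C else 0) =
    if i is 0 then 1%:M else 0.
  move/(congr1 (fun M : 'M_n => coefmx i M)): pC.
  rewrite -{1}[1%:M](map_mx1 (polyC : {rmorphism _ -> _})).
  rewrite coefmx_cst => <-; rewrite mulmxDl coefmxD coefmxM_cst -scalemxAl coefmxX.
  by case: i => // i; rewrite coefmxM_cst.
have ex : exists N, coefmx N C == 0 by have [N /eqP] := coefmx_large C; exists N.
(* With r.+1 the first index of a zero coefficient, C_r is nonzero by minimality and c C_r = 0 by
   the equation at r.+1. *)
case: (ex_minnP ex) => -[|r] /eqP Cr minr.
  have := eC 0%N; rewrite Cr mulmx0 add0r => /esym e1.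
  by case/negP: c0; rewrite -[c]mulmx1 e1 mulmx0.
have Cr0 : coefmx r C != 0 by apply/negP=> /minr; rewrite ltnn.
have cCr : c *m coefmx r C = 0 by have := eC r.+1; rewrite Cr mulmx0 add0r.
have CbC : (coefmx r C)^T *m b *m coefmx r C = 0.
  (* If r = 0, then C_0 inverts b and c C_0 = 0 forces c = 0. Otherwise b C_r = - c C_(r-1), and
     C_r^T c = 0 by symmetry. *)
  case: r Cr minr Cr0 cCr => [|r] Cr minr Cr0 cCr.
    have := eC 0%N; rewrite addr0 => /mulmx1C e1.
    by case/negP: c0; rewrite -[c]mulmx1 -e1 mulmxA cCr mul0mx.
  have /eqP := eC r.+1; rewrite addr_eq0 => /eqP e1.
  rewrite -mulmxA e1 mulmxN mulmxA -{1}sc -trmx_mul cCr.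
  by rewrite trmx0 mul0mx oppr0.
have [j vj] : exists j, col j (coefmx r C) != 0.
  apply/existsP; apply: contraNT Cr0; rewrite negb_exists => /forallP h.
  apply/eqP/matrixP=> i j; have := h j; rewrite negbK => /eqP/colP/(_ i).
  by rewrite !mxE.
exists (col j (coefmx r C)); split=> //.
  by rewrite colE mulmxA cCr mul0mx.
rewrite colE trmx_mul; set w := delta_mx j 0.
transitivity (w^T *m ((coefmx r C)^T *m b *m coefmx r C) *m w).
  by rewrite !mulmxA.
by rewrite CbC mulmx0 mul0mx.
Qed.

Lemma inv_size m n (P : 'M[k]_(m, n)) (Q : 'M[k]_(n, m)) :
  P *m Q = 1%:M -> Q *m P = 1%:M -> m = n.
Proof.
move=> PQ QP; have := mulmx_max_rank P Q; have := mulmx_max_rank Q P.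
by rewrite PQ QP !mxrank1 => h1 h2; apply/eqP; rewrite eqn_leq h1 h2.
Qed.

(** Induction on the size: the isotropic vector leaves a plane and a smaller pencil, again
    unimodular. The plane has different corners s at the two ends, which [stcong_metab] ignores. *)
Lemma pencil_stcong n (b c : 'M[k]_n) : b^T = b -> c^T = c ->
  pencil b c \in unitmx -> stcong b (b + c).
Proof.
have [N leN] := ubnP n; elim: N n leN b c => // N IHN n leN b c sb sc up.
have ub : b \in unitmx.
  rewrite -[b]addr0 -(scale0r c) -evmx_pencil unitmxE det_map_mx.
  by rewrite rmorph_unit -?unitmxE.
have [->|c0] := eqVneq c 0; first by rewrite addr0; apply: stcong_refl.
have [v [v0 cv vbv]] := pencil_isotropic (conj sb ub) sc c0 up.
have [m [P [Q [x [y [PQ QP eb ec [sx symnd]]]]]]] :=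
  isotropic_split (conj sb ub) sc v0 cv vbv.
have en := inv_size PQ QP.
have c_b : cong b (hsplit x) by exists P, Q; split.
have c_bc : cong (b + c) (hsplit (x + y)).
  exists P, Q; split=> //; rewrite mulmxDr mulmxDl eb ec /hsplit add_block_mx.
  by rewrite !addr0.
have c_p : cong (pencil b c) (hsplit (pencil x y)).
  exists (cstmx P), (cstmx Q); rewrite -!map_mxM PQ QP !map_mx1; split=> //.
  rewrite /pencil mulmxDr mulmxDl -scalemxAr -scalemxAl map_trmx -!map_mxM eb ec.
  rewrite /hsplit /cstmx !map_block_mx map_row_mx map_col_mx map_mx1 !map_mx0.
  by rewrite scale_block_mx add_block_mx !scaler0 !addr0.
have sxy : (x + y)^T = x + y by rewrite linearD /= sx symnd.
have spxy := symnd_pencil sx symnd.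
have /symnd_dsum[_ [_]] := symnd_cong (cong_trans c_p (cong_hsplit spxy))
  (conj (symnd_pencil sb sc) up).
have -> : drsubmx (pencil x y) = pencil (drsubmx x) (drsubmx y).
  by apply/matrixP=> i j; rewrite !mxE.
move/(IHN m _ _ _ _ _) => IH.
apply: stcong_trans (cong_stcong (cong_trans c_b (cong_hsplit sx))) _.
apply: stcong_trans (stcong_sym (cong_stcong (cong_trans c_bc (cong_hsplit sxy)))).
apply: stcong_dsum; first by apply: stcong_metab; rewrite trmx_ulsub ?sx ?sxy.
have -> : drsubmx (x + y) = drsubmx x + drsubmx y.
  by apply/matrixP=> i j; rewrite !mxE.
by apply: IH; rewrite ?trmx_drsub ?sx ?symnd //; move: leN; rewrite en; lia.
Qed.

Definition szle N m n (M : 'M[{poly k}]_(m, n)) := forall i j, (size (M i j) <= N)%N.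

Lemma szle_row N m n1 n2 (A : 'M_(m, n1)) (B : 'M_(m, n2)) :
  szle N A -> szle N B -> szle N (row_mx A B).
Proof. by move=> sA sB i j; rewrite !mxE; case: split. Qed.

Lemma szle_col N m1 m2 n (A : 'M_(m1, n)) (B : 'M_(m2, n)) :
  szle N A -> szle N B -> szle N (col_mx A B).
Proof. by move=> sA sB i j; rewrite !mxE; case: split. Qed.

Lemma szle_scalar N n (p : {poly k}) : (size p <= N)%N -> szle N (p%:M : 'M_n).
Proof.
by move=> sp i j; rewrite !mxE; case: (i == j); rewrite ?mulr0n ?size_poly0.
Qed.

Lemma szle_cst N i m n (A : 'M[k]_(m, n)) : (i < N)%N ->
  szle N (- ('X^i *: cstmx A)).
Proof.
move=> ltiN a b; rewrite !mxE size_polyN mulrC mul_polyC.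
by rewrite (leq_trans (size_scale_leq _ _)) // size_polyXn.
Qed.

Lemma homotopy_stcong n (M : 'M[{poly k}]_n) : symnd M -> stcong (evmx 0 M) (evmx 1 M).
Proof.
suff hom d : forall n (M : 'M[{poly k}]_n), symnd M ->
    (forall i j, (size (M i j) <= d.+2)%N) -> stcong (evmx 0 M) (evmx 1 M).
  move=> sM; apply: (hom (\max_i \max_j size (M i j))) => // i j.
  apply: leq_trans (leqW (leqnSn _)).
  apply: leq_trans (leq_bigmax i).
  exact: (leq_bigmax (F := fun j => size (M i j)) j).
elim: d => [|d IHd] {}n {}M [sM uM] szM.
  have eM : M = pencil (coefmx 0 M) (coefmx 1 M).
    apply/matrixP=> i j; rewrite !mxE; apply/polyP=> h.
    rewrite coefD coefC coefXM coefC; case: h => [|[|h]] //=; rewrite ?addr0 ?add0r //.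
    by rewrite nth_default // (leq_trans (szM i j)).
  have sc h : (coefmx h M)^T = coefmx h M.
    by apply/matrixP=> i j; rewrite !mxE -[in RHS]sM mxE.
  rewrite eM !evmx_pencil scale0r addr0 scale1r; apply: pencil_stcong => //.
  by rewrite -eM.
(* The top term is T^(2e) D with D of degree at most 1. Adding T^e times the second half of the
   basis of [metab (- D)] to the basis of M cancels it, and creates only entries of degree e and e +
   odd d, both below d + 2. *)
pose e := d./2.+1; pose D := 'X^(odd d) *: cstmx (coefmx d.+2 M).
pose h := metab (- D); pose Z := col_mx 0 ('X^e)%:M : 'M[{poly k}]_(n + n, n).
pose P := block_mx 1%:M 0 Z 1%:M.
pose M' := P^T *m dsum M h *m P.
have sD : D^T = D.
  rewrite /D linearZ /= map_trmx; congr (_ *: map_mx _ _).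
  by apply/matrixP=> i j; rewrite !mxE -[in RHS]sM mxE.
have sh : symnd h by apply: symnd_metab; rewrite linearN /= sD.
have cM : cong (dsum M h) M'.
  by apply: cong_unit; rewrite unitmxE det_lblock !det1 mulr1 unitr1.
have sM' : symnd M' by apply: symnd_cong cM _; apply/symnd_dsum.
have eM' : M' = col_mx (row_mx (M - 'X^(d.+2) *: cstmx (coefmx d.+2 M))
     (row_mx ('X^e)%:M (- ('X^(e + odd d) *: cstmx (coefmx d.+2 M)))))
   (row_mx (col_mx ('X^e)%:M (- ('X^(e + odd d) *: cstmx (coefmx d.+2 M))))
     (col_mx (row_mx 0 1%:M)
       (row_mx 1%:M (- ('X^(odd d) *: cstmx (coefmx d.+2 M)))))).
  have XD : 'X^e *: D = 'X^(e + odd d) *: cstmx (coefmx d.+2 M).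
    by rewrite /D scalerA -exprD.
  have XXD : 'X^e *: ('X^e *: D) = 'X^(d.+2) *: cstmx (coefmx d.+2 M).
    rewrite XD scalerA -exprD; congr ('X^_ *: _).
    by rewrite /e -[in RHS](odd_double_half d) -addnn; lia.
  rewrite -XXD -XD -/D -!/(block_mx _ _ _ _) -/(metab _) -/h /M' /P /dsum.
  rewrite tr_block_mx trmx0 !trmx1 !mulmx_block.
  rewrite !(mul0mx, mulmx0, addr0, add0r, mul1mx, mulmx1).
  have -> : Z^T *m h = row_mx ('X^e)%:M (- ('X^e *: D)).
    rewrite /Z tr_col_mx trmx0 tr_scalar_mx /h /metab mul_row_block.
    by rewrite !mul0mx !add0r mulmx1 mul_scalar_mx scalerN.
  have -> : h *m Z = col_mx ('X^e)%:M (- ('X^e *: D)).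
    rewrite /Z /h /metab mul_block_col.
    by rewrite !mulmx0 !add0r mul1mx mul_mx_scalar scalerN.
  by rewrite /Z mul_row_col mulmx0 add0r mul_mx_scalar scalerN.
have szM' : szle d.+2 M'.
  have le_d : (e + odd d < d.+2)%N.
    by rewrite /e -{3}(odd_double_half d) -addnn; lia.
  have sXe : szle d.+2 (('X^e)%:M : 'M_n).
    by apply: szle_scalar; rewrite size_polyXn; apply: leq_trans le_d; rewrite ltnS leq_addr.
  have sXD : szle d.+2 (- ('X^(e + odd d) *: cstmx (coefmx d.+2 M))).
    exact: szle_cst.
  rewrite eM'; apply: szle_col; apply: szle_row.
  - move=> i j; apply/leq_sizeP=> h' leh; rewrite !mxE coefB coefXnM.
    have [lt|gt|<-] := ltngtP d.+2 h'; [|by rewrite leqNgt gt in leh|by rewrite subnn coefC subrr].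
    rewrite coefC subn_eq0 leqNgt lt /= subr0 nth_default //.
    exact: leq_trans (szM i j) lt.
  - exact: szle_row.
  - exact: szle_col.
  apply: szle_col; apply: szle_row.
  - by move=> i j; rewrite mxE size_poly0.
  - by apply: szle_scalar; rewrite size_poly1.
  - by apply: szle_scalar; rewrite size_poly1.
  - by apply: szle_cst; case: (odd d).
have := IHd _ _ sM' szM'.
have ev t : stcong (evmx t M') (dsum (evmx t M) (evmx t h)).
  apply/stcong_sym/cong_stcong.
  have -> : dsum (evmx t M) (evmx t h) = evmx t (dsum M h).
    by rewrite /evmx /dsum [RHS]map_block_mx !map_mx0.
  exact: cong_map.
have evh t : evmx t h = metab (- evmx t D).
  rewrite /evmx /h /metab map_block_mx map_mx0 map_mx1; congr block_mx.
  exact: raddfN.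
have sev t : (- evmx t D)^T = - evmx t D.
  by rewrite linearN /= /evmx map_trmx sD.
(* The auxiliary h also depends on T, but its two ends are metabolic, hence stably congruent. *)
move=> ss; apply: (@stcong_cancel _ _ _ _ _ _ _ (evmx 0 h) (evmx 1 h)).
- by rewrite evh; apply: symnd_metab.
- by rewrite !evh; apply: stcong_metab.
exact: stcong_trans (stcong_sym (ev 0)) (stcong_trans ss (ev 1)).
Qed.
End HomotopyInvariance.

(** * Cancellation for anisotropic forms *)

Section Anisotropic.
Variable k : fieldType.

Definition aniso p (b : 'M[k]_p) := forall x : 'cV[k]_p, x^T *m b *m x = 0 -> x = 0.

Lemma aniso_mx p (b : 'M[k]_p) n (X : 'M[k]_(p, n)) :
  aniso b -> X^T *m b *m X = 0 -> X = 0.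
Proof.
move=> anb XbX; suff colX j : X *m delta_mx j (0 : 'I_1) = 0.
  by apply/matrixP=> i j; have /colP/(_ i) := colX j; rewrite -colE !mxE.
apply: anb; rewrite trmx_mul; set w := delta_mx j 0.
transitivity (w^T *m (X^T *m b *m X) *m w); first by rewrite !mulmxA.
by rewrite XbX mulmx0 mul0mx.
Qed.

(* For an isometry P of b + c with b' + c, the pairs (x, y) such that
   P (y, z) = (x, z) for some z form a Lagrangian of b - b'; as b is
   anisotropic it is the graph of an isometry. *)
Lemma aniso_stcong_cong p q (b : 'M[k]_p) (b' : 'M[k]_q) :
  aniso b -> symnd b' -> stcong b b' -> cong b b'.
Proof.
move=> anb [_ ub'] [m [c [[_ uc] [P [Q [PQ QP Pbc]]]]]].
have epq : p = q by have := inv_size PQ QP; lia.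
case: q / epq b' ub' P Q PQ QP Pbc => b' ub' P _ _ _ Pbc.
pose F := row_mx (dlsubmx P) (drsubmx P - 1%:M).
have P_fix n (G : 'M[k]_(n, p + m)) : G *m F^T = 0 ->
    P *m G^T = col_mx (ulsubmx P *m (lsubmx G)^T + ursubmx P *m (rsubmx G)^T) (rsubmx G)^T.
  move=> GF; rewrite -{1}[P]submxK -{1}[G]hsubmxK tr_row_mx mul_block_col.
  congr col_mx; apply/eqP; rewrite -subr_eq0 -addrA -[X in _ + (_ - X)]mul1mx -mulmxBl.
  by rewrite -mul_row_col -tr_row_mx hsubmxK -/F -[F]trmxK -trmx_mul GF trmx0.
pose pr : 'M[k]_(p + m, p) := col_mx 1%:M 0.
have prE n (G : 'M[k]_(n, p + m)) : G *m pr = lsubmx G.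
  by rewrite -{1}[G]hsubmxK mul_row_col mulmx1 mulmx0 addr0.
(* The rows (y, z) of E satisfy P (y, z) = (x, z) for some x; those of D have moreover y = 0. *)
pose E := kermx F^T; pose D := (E :&: kermx pr)%MS.
have DF : D *m F^T = 0 by apply/sub_kermxP; apply: capmxSl.
have Dl : lsubmx D = 0 by rewrite -prE; apply/sub_kermxP; apply: capmxSr.
pose Z := rsubmx D; have DE : D = row_mx 0 Z by rewrite -[D]hsubmxK Dl.
(* P sends (0, z) to (x, z) with b(x, x) = 0, so x = 0 and P fixes D. *)
have PD : P *m D^T = col_mx 0 Z^T.
  have := P_fix _ _ DF; rewrite Dl trmx0 mulmx0 add0r -/Z => PD.
  rewrite PD; congr col_mx; apply: (aniso_mx anb).
  have : D *m (P^T *m dsum b c *m P) *m D^T = D *m dsum b' c *m D^T by rewrite Pbc.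
  rewrite !mulmxA -[D *m P^T]trmxK trmx_mul trmxK -mulmxA PD DE tr_row_mx trmx0.
  rewrite tr_col_mx /dsum !mul_row_block !mul_row_col !(mulmx0, mul0mx, addr0, add0r).
  rewrite trmxK => e; apply: (addIr (Z *m c *m Z^T)).
  by rewrite add0r -[X in X + _]mulmxA; apply: e.
(* An isometry fixing (0, z) preserves the pairing with it, so z c annihilates F. As c is
   invertible, this bounds the rank of D. *)
have ZF : Z *m c *m F = 0.
  have : D *m (P^T *m dsum b c *m P) = D *m dsum b' c by rewrite Pbc.
  rewrite !mulmxA -[D *m P^T]trmxK trmx_mul trmxK PD DE tr_col_mx trmx0 trmxK.
  rewrite /dsum !mul_row_block !(mulmx0, mul0mx, addr0, add0r).
  rewrite -[P]submxK mul_row_block !mul0mx !add0r => /eq_row_mx[e1 e2].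
  by rewrite /F mul_mx_row mulmxBr e1 e2 mulmx1 subrr row_mx0.
have rD : (\rank D <= m - \rank F)%N.
  rewrite -mxrank_ker; apply: leq_trans (_ : \rank (Z *m c) <= _)%N.
    rewrite mxrankMfree ?row_free_unit // DE -[Z in row_mx 0 Z]mulmx1.
    by rewrite -[X in row_mx X _](mulmx0 _ Z) -mul_mx_row mxrankM_maxl.
  by apply/mxrankS/sub_kermxP.
(* dim E - dim D is at least (p + m - rank F) - (m - rank F) = p, so every y occurs. *)
have fullY : row_full (E *m pr).
  rewrite /row_full eqn_leq rank_leq_col.
  have := mxrank_mul_ker E pr; rewrite -/D mxrank_ker mxrank_tr.
  by have := rank_leq_row F; move: rD; lia.
have [S SY] := row_fullP fullY; pose W := S *m E.
have WF : W *m F^T = 0 by rewrite /W -mulmxA mulmx_ker mulmx0.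
have Wl : lsubmx W = 1%:M by rewrite -prE /W -mulmxA.
have := P_fix _ _ WF; rewrite Wl trmx1 mulmx1.
set R := (_ + _); set s := (rsubmx W)^T => PW.
apply: (@cong_of_eq _ _ _ _ R) => //.
have : W *m (P^T *m dsum b c *m P) *m W^T = W *m dsum b' c *m W^T by rewrite Pbc.
rewrite !mulmxA -[W *m P^T]trmxK trmx_mul trmxK -mulmxA PW -[W]hsubmxK Wl.
rewrite -[rsubmx W]trmxK -/s tr_row_mx tr_col_mx trmxK trmx1 /dsum.
rewrite !mul_row_block !mul_row_col !(mulmx0, mul0mx, addr0, add0r, mulmx1, mul1mx).
exact: addIr.
Qed.
End Anisotropic.

(** * Pointed pairs and continued fractions *)

Section PointedPairs.
Variable R : idomainType.
Implicit Types p : {poly R} * {poly R}.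

(** For monic A, a Bezout identity amounts to a unit resultant over any domain, k[T] included, and
    it is stable under base change. *)
Definition pointed n p := [/\ p.1 \is monic, size p.1 = n.+1, (size p.2 <= n)%N &
  exists U V, U * p.1 + V * p.2 = 1].

Lemma pointed_spans n p : pointed n p -> spans n p.1 p.2.
Proof.
case: p => A B [/= mA sA sB [U [V eUV]]] j ltj.
pose V' := Pdiv.Ring.rmodp (V * 'X^j) A.
pose U' := U * 'X^j + Pdiv.Ring.rdivp (V * 'X^j) A * B.
have eV : V * 'X^j = Pdiv.Ring.rdivp (V * 'X^j) A * A + V'.
  exact: Pdiv.RingMonic.rdivp_eq.
have e : U' * A + V' * B = 'X^j.
  transitivity ((U * A + V * B) * 'X^j); last by rewrite eUV mul1r.
  transitivity (U * A * 'X^j + (V * 'X^j) * B); last by ring.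
  by rewrite eV /U'; ring.
have sV' : (size V' <= n)%N.
  by rewrite -ltnS -sA Pdiv.Ring.ltn_rmodpN0 // monic_neq0.
exists U', V'; split=> //; have [->|U0] := eqVneq U' 0; first by rewrite size_poly0.
have : (size (U' * A)%R <= n + n)%N.
  rewrite -[U' * A](addrK (V' * B)) e (leq_trans (size_polyD _ _)) // size_polyN.
  rewrite geq_max size_polyXn ltj (leq_trans (size_polyMleq _ _)) //.
  by rewrite (leq_trans (leq_pred _)) // leq_add.
by rewrite size_Mmonic // sA addnS /= leq_add2r.
Qed.

Lemma pointed_Un n p : pointed n p -> Un_point n p.1 p.2.
Proof.
move=> pp; have := pointed_spans pp; case: pp => mA sA sB _ sp; split.
- by rewrite sA.
- exact: leqW.
- exists (fun i => (i == n)%:R), (fun=> 0); rewrite big_ord_recr /= eqxx.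
  move: mA; rewrite monicE lead_coefE sA /= => /eqP ->; rewrite mul0r addr0 mulr1.
  by rewrite big1 ?add0r // => i _; rewrite ltn_eqF // mulr0n !mul0r addr0.
- exact: spans_res.
Qed.

(** The matrix [H1 -V; H2 U] acting on the column p. In [sl2head] its determinant is 1 and the
    degree bounds make H1 A dominate V B. *)
Definition mobius (H1 H2 U V : {poly R}) p := (H1 * p.1 - V * p.2, H2 * p.1 + U * p.2).

Definition sl2head d (H1 H2 U V : {poly R}) :=
  [/\ H1 \is monic, size H1 = d.+1, (size H2 <= d)%N, (size U <= d)%N /\
      (size V <= d)%N & U * H1 + V * H2 = 1].

Lemma mobius_pointed d m H1 H2 U V p :
  sl2head d H1 H2 U V -> pointed m p -> pointed (d + m) (mobius H1 H2 U V p).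
Proof.
case: p => A B [mH sH sH2 [sU sV] eH] [/= mA sA sB [U' [V' eU]]].
have sHA : size (H1 * A) = (d + m).+1.
  by rewrite size_Mmonic ?monic_neq0 // sH sA addnS.
have sVB : (size (V * B)%R < size (H1 * A)%R)%N.
  rewrite sHA ltnS (leq_trans (size_polyMleq _ _)) //.
  by rewrite (leq_trans (leq_pred _)) // leq_add.
split=> /=.
- by rewrite monicE lead_coefDl ?size_polyN // -monicE rpredM.
- by rewrite size_polyDl ?size_polyN.
- rewrite (leq_trans (size_polyD _ _)) // geq_max.
  rewrite (leq_trans (size_polyMleq _ _)) ?sA ?addnS ?leq_add2r //=.
  rewrite (leq_trans (size_polyMleq _ _)) //.
  by rewrite (leq_trans (leq_pred _)) // leq_add.
(* The row (U', V') times the inverse matrix [U V; -H2 H1]. *)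
exists (U' * U - V' * H2), (U' * V + V' * H1).
transitivity ((U * H1 + V * H2) * (U' * A + V' * B)); first by ring.
by rewrite eH eU mul1r.
Qed.

End PointedPairs.

Definition mapp (R S : nzRingType) (f : R -> S) (p : {poly R} * {poly R}) :=
  (map_poly f p.1, map_poly f p.2).

Section Maps.
Variables (R S : idomainType) (f : {rmorphism R -> S}).

Lemma size_map_monic (p : {poly R}) : p \is monic -> size (map_poly f p) = size p.
Proof.
by move=> /monicP lp; rewrite size_map_poly_id0 // lp rmorph1 oner_neq0.
Qed.

Lemma size_map_le (p : {poly R}) : (size (map_poly f p) <= size p)%N.
Proof. exact: size_poly. Qed.

Lemma pointed_map n p : pointed n p -> pointed n (mapp f p).
Proof.
case=> mA sA sB [U [V e]]; split=> /=; first exact: monic_map.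
- by rewrite size_map_monic.
- exact: leq_trans (size_map_le _) sB.
by exists (map_poly f U), (map_poly f V); rewrite -!rmorphM -rmorphD e rmorph1.
Qed.

Lemma sl2head_map d H1 H2 U V : sl2head d H1 H2 U V ->
  sl2head d (map_poly f H1) (map_poly f H2) (map_poly f U) (map_poly f V).
Proof.
case=> mA sA sB [sU sV] e; split=> /=; first exact: monic_map.
- by rewrite size_map_monic.
- exact: leq_trans (size_map_le _) sB.
- by split; apply: leq_trans (size_map_le _) _.
by rewrite -!rmorphM -rmorphD e rmorph1.
Qed.

Lemma mobius_map H1 H2 U V p : mapp f (mobius H1 H2 U V p) =
  mobius (map_poly f H1) (map_poly f H2) (map_poly f U) (map_poly f V) (mapp f p).
Proof. by rewrite /mapp /mobius /= rmorphB rmorphD /= !rmorphM. Qed.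

Lemma Un_point_map n A B : Un_point n A B ->
  Un_point n (map_poly f A) (map_poly f B).
Proof.
case=> sA sB [u [v uv]] ures; split.
- exact: leq_trans (size_map_le _) sA.
- exact: leq_trans (size_map_le _) sB.
- exists (fun i => f (u i)), (fun i => f (v i)); rewrite -(rmorph1 f) -uv rmorph_sum.
  by apply: eq_bigr => i _; rewrite !coef_map rmorphD !rmorphM.
suff -> : res_nn n (map_poly f A) (map_poly f B) = f (res_nn n A B).
  exact: rmorph_unit.
rewrite /res_nn -det_map_mx /sylv_nn map_col_mx; congr (\det (col_mx _ _)).
  by apply/matrixP=> i j; rewrite !mxE -(map_polyXn f) -rmorphM coef_map.
by apply/matrixP=> i j; rewrite !mxE -(map_polyXn f) -rmorphM coef_map.
Qed.
End Maps.

Section Homotopies.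
Variable k : fieldType.
Implicit Types p q : {poly k} * {poly k}.

Definition cstp p := mapp (polyC : k -> {poly k}) p.
Definition evp (t : k) (H : {poly {poly k}} * {poly {poly k}}) := mapp (horner_eval t) H.

Lemma map_horner_cst t (A : {poly k}) : map_poly (horner_eval t) A^:P = A.
Proof. by apply/polyP=> i; rewrite coef_map coef_map /= /horner_eval hornerC. Qed.

Lemma evp_cst t p : evp t (cstp p) = p.
Proof. by case: p => A B; rewrite /evp /cstp /mapp /= !map_horner_cst. Qed.

Definition pstep n p q := exists H, pointed n H /\ p = evp 0 H /\ q = evp 1 H.
Definition pequiv n := clos_refl_sym_trans _ (pstep n).

Lemma pequiv_refl n p : pequiv n p p.
Proof. exact: rst_refl. Qed.
Lemma pequiv_sym n p q : pequiv n p q -> pequiv n q p.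
Proof. exact: rst_sym. Qed.
Lemma pequiv_trans n p q r : pequiv n p q -> pequiv n q r -> pequiv n p r.
Proof. exact: rst_trans. Qed.

Lemma pequiv_naive n p q : pequiv n p q -> naive_equiv n p q.
Proof.
elim=> {p q} [p q [H [pH [-> ->]]]|p|p q _|p q r _ h1 _ h2].
- apply: rst_step; right; exists H.1, H.2; split=> //; exact: pointed_Un.
- exact: rst_refl.
- exact: rst_sym.
- exact: rst_trans h1 h2.
Qed.

Lemma pequiv_mobius d m H1 H2 U V p q : sl2head d H1 H2 U V ->
  pequiv m p q -> pequiv (d + m) (mobius H1 H2 U V p) (mobius H1 H2 U V q).
Proof.
move=> hH; elim=> {p q} [p q [H [pH [-> ->]]]|p|p q _|p q r _ h1 _ h2].
- apply: rst_step.
  exists (mobius H1^:P H2^:P U^:P V^:P H); split.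
    by apply: mobius_pointed pH; apply: sl2head_map hH.
  by rewrite /evp !mobius_map !map_horner_cst.
- exact: rst_refl.
- exact: rst_sym.
- exact: rst_trans h1 h2.
Qed.

(** A moving head on a constant tail; [pequiv_mobius] is the opposite case. *)
Lemma pequiv_head d m (H1 H2 U V : {poly {poly k}}) p :
  sl2head d H1 H2 U V -> pointed m p ->
  let ev t := map_poly (horner_eval t) in
  pequiv (d + m) (mobius (ev 0 H1) (ev 0 H2) (ev 0 U) (ev 0 V) p)
                 (mobius (ev 1 H1) (ev 1 H2) (ev 1 U) (ev 1 V) p).
Proof.
move=> hH pp ev; apply: rst_step; exists (mobius H1 H2 U V (cstp p)); split.
  by apply: mobius_pointed hH _; apply: pointed_map.
by rewrite /evp !mobius_map -![mapp _ (cstp p)]/(evp _ (cstp p)) !evp_cst.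
Qed.

End Homotopies.

(** * Heads of degree two and the moves they give *)

Section RankTwo.
Variable R : idomainType.

Lemma size_lin (a b : R) : (size (a%:P * 'X + b%:P)%R <= 2)%N.
Proof. by rewrite size_MXaddC; case: ifP => // _; rewrite ltnS size_polyC_leq1. Qed.

(* [di] stands for the inverse of x z - y^2; the Bezout form of
   (H1, H2) has entries x, y, y, z. *)
Definition two1 (x y di : R) : {poly R} := 'X^2 - ((x * y * di)%:P * 'X + (x ^+ 2 * di)%:P).
Definition two2 (y z : R) : {poly R} := z%:P * 'X + y%:P.
Definition twoU (z di : R) : {poly R} := - (z ^+ 2 * di)%:P.
Definition twoV (x y z di : R) : {poly R} :=
  (z * di)%:P * 'X + (- (y * (x * z + x * z - y ^+ 2) * di ^+ 2))%:P.

Lemma sl2head_two x y z di : (x * z - y ^+ 2) * di = 1 ->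
  sl2head 2 (two1 x y di) (two2 y z) (twoU z di) (twoV x y z di).
Proof.
move=> e; have s1 : (size ((x * y * di)%:P * 'X + (x ^+ 2 * di)%:P)%R < 3)%N.
  by rewrite ltnS size_lin.
split.
- by rewrite monicE lead_coefDl ?size_polyN ?size_polyXn // lead_coefXn.
- by rewrite size_polyDl ?size_polyN ?size_polyXn.
- exact: size_lin.
- by rewrite size_lin /twoU size_polyN (leq_trans (size_polyC_leq1 _)).
have := congr1 (fun c => c%:P) e; rewrite /two1 /two2 /twoU /twoV.
rewrite !(rmorphM, rmorphB, rmorphN, rmorphD, rmorphXn, rmorph1) /=.
move: x%:P y%:P z%:P di%:P => X Y Z D eD.
(* The Bezout combination is regrouped as a polynomial in (X Z - Y^2) D, so that [eD] applies; no
   division by z occurs, and z may be 0. *)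
transitivity ((X * Z - Y ^+ 2) * D * ((X * Z - Y ^+ 2) * D)
   + Z * Y * D * 'X * (1 - (X * Z - Y ^+ 2) * D)); first by ring.
by rewrite eD; ring.
Qed.
End RankTwo.

Section Moves.
Variable k : fieldType.
Implicit Types p q : {poly k} * {poly k}.

Definition rank2 (di x y z : k) p :=
  mobius (two1 x y di) (two2 y z) (twoU z di) (twoV x y z di) p.

Lemma ev_two t (X Y Z : {poly k}) di : let ev := map_poly (horner_eval t) in
  [/\ ev (two1 X Y di%:P) = two1 X.[t] Y.[t] di, ev (two2 Y Z) = two2 Y.[t] Z.[t],
      ev (twoU Z di%:P) = twoU Z.[t] di &
      ev (twoV X Y Z di%:P) = twoV X.[t] Y.[t] Z.[t] di].
Proof.
rewrite /two1 /two2 /twoU /twoV; split.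
- rewrite rmorphB /= map_polyXn rmorphD rmorphM /= !map_polyC map_polyX /=.
  by rewrite /horner_eval ?hornerE.
- rewrite rmorphD rmorphM /= !map_polyC map_polyX /=.
  by rewrite /horner_eval ?hornerE.
- rewrite rmorphN /= !map_polyC /=.
  by rewrite /horner_eval ?hornerE.
- rewrite rmorphD rmorphM /= !map_polyC map_polyX /=.
  by rewrite /horner_eval ?hornerE.
Qed.

Lemma pequiv_two m di (X Y Z : {poly k}) p : pointed m p ->
  (X * Z - Y ^+ 2) * di%:P = 1 ->
  pequiv (2 + m) (rank2 di X.[0] Y.[0] Z.[0] p) (rank2 di X.[1] Y.[1] Z.[1] p).
Proof.
move=> pp /sl2head_two hH; have := pequiv_head hH pp.
have [/= -> -> -> ->] := ev_two 0 X Y Z di.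
by have [/= -> -> -> ->] := ev_two 1 X Y Z di.
Qed.

Section Shears.
Variables (m : nat) (di x y z : k) (p : {poly k} * {poly k}).
Hypotheses (pp : pointed m p) (e : (x * z - y ^+ 2) * di = 1).

Let eC : (x%:P * z%:P - y%:P ^+ 2) * di%:P = 1.
Proof. by rewrite -rmorphXn -!(rmorphM, rmorphB) /= e. Qed.

Lemma pequiv_shear1 s : pequiv (2 + m) (rank2 di x y z p)
  (rank2 di (x + s * y + s * y + s ^+ 2 * z) (y + s * z) z p).
Proof.
pose X := x%:P + s%:P * 'X * (y%:P + y%:P) + (s%:P * 'X) ^+ 2 * z%:P.
pose Y := y%:P + s%:P * 'X * z%:P.
have eXY : (X * z%:P - Y ^+ 2) * di%:P = 1 by rewrite -[RHS]eC /X /Y; ring.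
have := pequiv_two pp eXY.
have -> : X.[0] = x by rewrite !hornerE; ring.
have -> : X.[1] = x + s * y + s * y + s ^+ 2 * z by rewrite !hornerE; ring.
have -> : Y.[0] = y by rewrite !hornerE; ring.
have -> : Y.[1] = y + s * z by rewrite !hornerE; ring.
by rewrite !hornerC.
Qed.

Lemma pequiv_shear2 s : pequiv (2 + m) (rank2 di x y z p)
  (rank2 di x (y + s * x) (z + s * y + s * y + s ^+ 2 * x) p).
Proof.
pose Z := z%:P + s%:P * 'X * (y%:P + y%:P) + (s%:P * 'X) ^+ 2 * x%:P.
pose Y := y%:P + s%:P * 'X * x%:P.
have eYZ : (x%:P * Z - Y ^+ 2) * di%:P = 1 by rewrite -[RHS]eC /Z /Y; ring.
have := pequiv_two pp eYZ.
have -> : Z.[0] = z by rewrite !hornerE; ring.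
have -> : Z.[1] = z + s * y + s * y + s ^+ 2 * x by rewrite !hornerE; ring.
have -> : Y.[0] = y by rewrite !hornerE; ring.
have -> : Y.[1] = y + s * x by rewrite !hornerE; ring.
by rewrite !hornerC.
Qed.
End Shears.

(** For x = 0 the determinant does not involve z, so z moves freely along a line. In characteristic
    2 the two ends need not be isometric. *)
Lemma pequiv_plane m di y z z' p : pointed m p -> (- y ^+ 2) * di = 1 ->
  pequiv (2 + m) (rank2 di 0 y z p) (rank2 di 0 y z' p).
Proof.
move=> pp e; pose Z := z%:P + 'X * (z'%:P - z%:P).
have eZ : (0%:P * Z - y%:P ^+ 2) * di%:P = 1.
  by rewrite mul0r sub0r -rmorphXn -rmorphN -rmorphM /= e.
have := pequiv_two pp eZ.
have -> : Z.[0] = z by rewrite !hornerE; ring.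
have -> : Z.[1] = z' by rewrite !hornerE /=; ring.
by rewrite !hornerC.
Qed.

(** The continued fraction step A/B -> P/a - B/(a^2 A), normalised to determinant 1. *)
Definition phi (P : {poly k}) a p := (P * p.1 - a^-1 *: p.2, a *: p.1).

Lemma phiE P a p : phi P a p = mobius P a%:P 0 (a^-1)%:P p.
Proof. by rewrite /phi /mobius -!mul_polyC mul0r addr0. Qed.

Lemma sl2head_phi d (P : {poly k}) (a : k) : P \is monic -> size P = d.+2 -> a != 0 ->
  sl2head d.+1 P a%:P 0 (a^-1)%:P.
Proof.
move=> mP sP a0; split=> //.
- by rewrite (leq_trans (size_polyC_leq1 _)).
- by rewrite size_poly0 (leq_trans (size_polyC_leq1 _)).
by rewrite mul0r add0r -polyCM mulVf.
Qed.

Fixpoint cfrac (u : seq k) : {poly k} * {poly k} :=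
  if u is a :: u' then phi 'X a (cfrac u') else (1, 0).

Definition nonzeros (u : seq k) := all (fun a => a != 0) u.

Lemma pointed_phi d m (P : {poly k}) a p : P \is monic -> size P = d.+2 -> a != 0 ->
  pointed m p ->
  pointed (d.+1 + m) (phi P a p).
Proof. by move=> mP sP a0; rewrite phiE; apply/mobius_pointed/sl2head_phi. Qed.

Lemma pointed_cfrac u : nonzeros u -> pointed (size u) (cfrac u).
Proof.
elim: u => [_|a u IHu /= /andP[a0 /IHu]].
  split=> /=; rewrite ?monic1 ?size_poly1 ?size_poly0 //.
  by exists 1, 0; rewrite mulr1 mul0r addr0.
by apply: (@pointed_phi 0); rewrite ?monicX ?size_polyX.
Qed.

Lemma pequiv_phi m (P : {poly k}) a p q : P \is monic -> size P = 2 -> a != 0 ->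
  pequiv m p q -> pequiv m.+1 (phi P a p) (phi P a q).
Proof.
by move=> mP sP a0; rewrite !phiE; apply/(@pequiv_mobius _ 1)/sl2head_phi.
Qed.

Lemma pequiv_cons a u v : a != 0 -> pequiv (size u) (cfrac u) (cfrac v) ->
  pequiv (size u).+1 (cfrac (a :: u)) (cfrac (a :: v)).
Proof. by move=> a0; apply: pequiv_phi; rewrite ?monicX ?size_polyX. Qed.

(** The order is reversed: in the basis 1, X of the Bezout form, the outer quotient X/a owns the top
    power X, hence the entry z. *)
Lemma cf2E a b u : a != 0 -> b != 0 ->
  cfrac [:: a, b & u] = rank2 (a * b)^-1 b 0 a (cfrac u).
Proof.
move=> a0 b0 /=; case: (cfrac u) => A B; rewrite /phi /rank2 /mobius /= /two1 /two2 /twoU /twoV.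
rewrite -!mul_polyC !(mulr0, mul0r, rmorph0, oppr0, addr0, add0r).
have -> : b ^+ 2 * (a * b)^-1 = b / a by field; rewrite a0 b0.
have -> : a * (a * b)^-1 = b^-1 by field; rewrite a0 b0.
have -> : a ^+ 2 * (a * b)^-1 = a / b by field; rewrite a0 b0.
have e1 : (b / a)%:P = b%:P * (a^-1)%:P by rewrite -polyCM.
have e2 : (a / b)%:P = a%:P * (b^-1)%:P by rewrite -polyCM.
by rewrite e1 e2; congr (_, _); ring.
Qed.

Section TwoMoves.
Variables (a b : k) (u : seq k).
Hypotheses (a0 : a != 0) (b0 : b != 0) (nu : nonzeros u).

Let pu := pointed_cfrac nu.
Let di := (a * b)^-1.

Let eab x y z : x * z - y ^+ 2 = a * b -> (x * z - y ^+ 2) * di = 1.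
Proof. by move=> ->; rewrite mulfV // mulf_neq0. Qed.

(* the congruence by the Weyl element (0, s; -1/s, 0), as a product of shears *)
Lemma pequiv_swap_scale s : s != 0 ->
  pequiv (size u).+2 (cfrac [:: a, b & u]) (cfrac [:: b / s ^+ 2, s ^+ 2 * a & u]).
Proof.
move=> s0; rewrite !cf2E ?mulf_neq0 ?invr_eq0 ?expf_neq0 //.
have -> : (b / s ^+ 2 * (s ^+ 2 * a))^-1 = di by rewrite /di; field; rewrite a0 b0.
have h1 := pequiv_shear1 pu (@eab b 0 a _) s.
apply: pequiv_trans (h1 _) _; first by ring.
rewrite !(mulr0, addr0, add0r).
have h2 := pequiv_shear2 pu (@eab (b + s ^+ 2 * a) (s * a) a _) (- s^-1).
apply: pequiv_trans (h2 _) _; first by ring.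
have -> : s * a + - s^-1 * (b + s ^+ 2 * a) = - (b / s) by field.
have -> : a + - s^-1 * (s * a) + - s^-1 * (s * a) + (- s^-1) ^+ 2 * (b + s ^+ 2 * a)
   = b / s ^+ 2 by field.
have h3 := pequiv_shear1 pu (@eab (b + s ^+ 2 * a) (- (b / s)) (b / s ^+ 2) _) s.
apply: pequiv_trans (h3 _) _; first by field.
have -> : b + s ^+ 2 * a + s * - (b / s) + s * - (b / s) + s ^+ 2 * (b / s ^+ 2)
  = s ^+ 2 * a by field.
have -> : - (b / s) + s * (b / s ^+ 2) = 0 by field.
exact: pequiv_refl.
Qed.

Lemma pequiv_swap : pequiv (size u).+2 (cfrac [:: a, b & u]) (cfrac [:: b, a & u]).
Proof.
by have := pequiv_swap_scale (oner_neq0 k); rewrite expr1n divr1 mul1r.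
Qed.

End TwoMoves.

Section Represent.
Variables (a b : k) (u : seq k).
Hypotheses (a0 : a != 0) (b0 : b != 0) (nu : nonzeros u).

Let pu := pointed_cfrac nu.
Let di := (a * b)^-1.

Let eab x y z : x * z - y ^+ 2 = a * b -> (x * z - y ^+ 2) * di = 1.
Proof. by move=> ->; rewrite mulfV // mulf_neq0. Qed.

(** The new entry is the value of <a, b> at (s, 1). One shear makes it diagonal, a second clears the
    off-diagonal entry, and a swap brings it to the front. *)
Lemma pequiv_represent s : b + s ^+ 2 * a != 0 ->
  pequiv (size u).+2 (cfrac [:: a, b & u])
    (cfrac [:: b + s ^+ 2 * a, a * b / (b + s ^+ 2 * a) & u]).
Proof.
set c := b + s ^+ 2 * a => c0.
apply: pequiv_trans (_ : pequiv _ _ (cfrac [:: a * b / c, c & u])) _; last first.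
  by apply: pequiv_swap; rewrite ?mulf_neq0 ?invr_eq0.
rewrite !cf2E ?mulf_neq0 ?invr_eq0 //.
have -> : (a * b / c * c)^-1 = di by rewrite divfK.
have h1 := pequiv_shear1 pu (@eab b 0 a _) s.
apply: pequiv_trans (h1 _) _; first by ring.
rewrite !(mulr0, addr0, add0r) -/c.
have h2 := pequiv_shear2 pu (@eab c (s * a) a _) (- (s * a) / c).
apply: pequiv_trans (h2 _) _; first by rewrite /c; ring.
have -> : s * a + - (s * a) / c * c = 0 by field.
have -> : a + - (s * a) / c * (s * a) + - (s * a) / c * (s * a) +
    (- (s * a) / c) ^+ 2 * c = a * b / c.
  transitivity (a * (c - s ^+ 2 * a) / c); first by field.
  by rewrite /c addrK.
exact: pequiv_refl.
Qed.
End Represent.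

Lemma pequiv_move_square a b t u : a != 0 -> b != 0 -> t != 0 -> nonzeros u ->
  pequiv (size u).+2 (cfrac [:: a * t ^+ 2, b & u]) (cfrac [:: a, b * t ^+ 2 & u]).
Proof.
move=> a0 b0 t0 nu; have tV0 : t^-1 != 0 by rewrite invr_eq0.
apply: pequiv_trans (pequiv_swap_scale _ b0 nu tV0) _; first by rewrite mulf_neq0 ?expf_neq0.
have -> : b / t^-1 ^+ 2 = b * t ^+ 2 by rewrite exprVn invrK.
have -> : t^-1 ^+ 2 * (a * t ^+ 2) = a by field.
by apply: pequiv_swap; rewrite ?mulf_neq0 ?expf_neq0.
Qed.

(** Both sides are shears of planes [0 c; c z], with z = a and z = a', joined by [pequiv_plane]. *)
Lemma pequiv_splits_plane a a' c u : a != 0 -> a' != 0 -> c != 0 -> nonzeros u ->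
  pequiv (size u).+2 (cfrac [:: a, - (c ^+ 2 / a) & u]) (cfrac [:: a', - (c ^+ 2 / a') & u]).
Proof.
move=> + + c0 nu; have pu := pointed_cfrac nu.
have key b : b != 0 -> pequiv (size u).+2 (rank2 (- c ^+ 2)^-1 0 c b (cfrac u))
    (cfrac [:: b, - (c ^+ 2 / b) & u]).
  move=> b0; have e : (0 * b - c ^+ 2) * (- c ^+ 2)^-1 = 1.
    by rewrite mul0r sub0r mulfV // oppr_eq0 expf_neq0.
  apply: pequiv_trans (pequiv_shear1 pu e (- c / b)) _.
  rewrite cf2E // ?oppr_eq0 ?mulf_neq0 ?invr_eq0 ?expf_neq0 //.
  have -> : 0 + - c / b * c + - c / b * c + (- c / b) ^+ 2 * b = - (c ^+ 2 / b) by field.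
  have -> : c + - c / b * b = 0 by field.
  have -> : b * - (c ^+ 2 / b) = - c ^+ 2 by field.
  exact: pequiv_refl.
move=> a0 a'0; apply: pequiv_trans (pequiv_sym (key a a0)) _.
apply: pequiv_trans _ (key a' a'0); apply: pequiv_plane pu _.
by rewrite mulfV // oppr_eq0 expf_neq0.
Qed.
End Moves.

(** * Reduction to linear partial quotients *)

Section NormalForm.
Variable k : fieldType.
Implicit Types p q : {poly k} * {poly k}.

(** A Euclidean division by B made monic. The size of p.2 is recorded because it tells whether the
    quotient P is linear. *)
Lemma pointed_euclid n p : pointed n.+1 p -> exists d m (P : {poly k}) b q,
  [/\ n.+1 = (d.+1 + m)%N, P \is monic, size P = d.+2, b != 0 &
      pointed m q /\ p = phi P b q] /\ size p.2 = m.+1.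
Proof.
case: p => A B [/= mA sA sB [U [V eUV]]].
have B0 : B != 0.
  apply/eqP=> B0; have e : U * A = 1 by rewrite -eUV B0 mulr0 addr0.
  have U0 : U != 0.
    by apply/eqP=> U0; move/eqP: e; rewrite U0 mul0r eq_sym oner_eq0.
  have := size_Mmonic U0 mA; rewrite e sA size_poly1 addnS /= => /esym/eqP.
  by rewrite addnS eqSS addn_eq0 size_poly_eq0 (negbTE U0).
have sB0 : (0 < size B)%N by rewrite size_poly_gt0.
pose b := lead_coef B; have b0 : b != 0 by rewrite lead_coef_eq0.
pose A1 := b^-1 *: B; pose P := A %/ A1; pose r := A %% A1.
have mA1 : A1 \is monic by rewrite monicE lead_coefZ mulVf.
have sA1 : size A1 = size B by rewrite size_scale ?invr_eq0.
have eA : A = P * A1 + r by apply: divp_eq.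
have sr : (size r < size A1)%N by rewrite ltn_modp monic_neq0.
have sP : size P = (n.+2 - (size B).-1)%N.
  by rewrite size_divp ?monic_neq0 // sA sA1.
have mP : P \is monic.
  rewrite monicE -(lead_coef_Mmonic P mA1) -[P * A1](addrK r) -eA.
  rewrite lead_coefDl ?size_polyN ?sA -?monicE //.
  by rewrite (leq_trans sr) // sA1 (leq_trans sB).
exists (n - (size B).-1)%N, (size B).-1, P, b, (A1, - b *: r).
split; last by rewrite prednK.
have leB : ((size B).-1 <= n)%N by rewrite -ltnS prednK.
split=> //; [by rewrite addSn subnK | by rewrite sP !subSn ?leqW |].
have eB : B = b *: A1 by rewrite /A1 scalerA mulfV // scale1r.
split; last by rewrite /phi /= -eB scalerA mulrN mulVf // scaleN1r opprK -eA.
split=> //=; first by rewrite sA1 prednK.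
  by rewrite size_scale ?oppr_eq0 // -ltnS prednK // -sA1.
exists (U * P + b *: V), (- b^-1 *: U); rewrite -[RHS]eUV [in RHS]eA [in RHS]eB.
rewrite -!mul_polyC !rmorphN /=; have : b%:P * (b^-1)%:P = 1 by rewrite -polyCM mulfV.
move: b%:P (b^-1)%:P => c c' e; transitivity (U * P * A1 + V * (c * A1) + c * c' * U * r).
  by ring.
by rewrite e; ring.
Qed.

Lemma pequiv_phi_Xn d m (P : {poly k}) b q : P \is monic -> size P = d.+2 ->
  b != 0 -> pointed m q -> pequiv (d.+1 + m) (phi P b q) (phi 'X^(d.+1) b q).
Proof.
move=> mP sP b0 pq.
pose H : {poly {poly k}} := P^:P + ('X)%:P * ('X^(d.+1) - P)^:P.
have sXP : (size ('X^(d.+1) - P)%R < d.+2)%N.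
  rewrite ltnS; apply/leq_sizeP=> j; rewrite leq_eqVlt => /predU1P[<-|ltj].
    move: mP; rewrite monicE lead_coefE sP /= => /eqP lP.
    by rewrite coefB coefXn eqxx lP subrr.
  by rewrite coefB coefXn gtn_eqF // nth_default ?subr0 // sP.
have hH : sl2head d.+1 H (b%:P)%:P 0 ((b^-1)%:P)%:P.
  have sH : (size (('X)%:P * ('X^(d.+1) - P)^:P)%R < size P^:P)%N.
    rewrite mul_polyC (leq_ltn_trans (size_scale_leq _ _)) //.
    by rewrite !size_map_polyC sP.
  split.
  - rewrite monicE /H lead_coefDl // -monicE; exact: monic_map.
  - by rewrite /H size_polyDl // size_map_polyC.
  - by rewrite (leq_trans (size_polyC_leq1 _)).
  - by rewrite size_poly0 (leq_trans (size_polyC_leq1 _)).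
  by rewrite mul0r add0r -!polyCM mulVf.
have evH t : map_poly (horner_eval t) H = P + t%:P * ('X^(d.+1) - P).
  by rewrite /H rmorphD /= rmorphM /= map_polyC /= !map_horner_cst /horner_eval hornerX.
have := pequiv_head hH pq; rewrite /= rmorph0 !map_polyC /= /horner_eval !hornerC.
by rewrite -/(horner_eval _) !evH mul0r addr0 mul1r [P + _]addrC subrK -!phiE.
Qed.

(** At T = 1 the denominator has the largest degree allowed, so its Euclidean quotient is linear. *)
Lemma pequiv_raise d m b q : b != 0 -> pointed m q ->
  exists r, [/\ pointed (d.+2 + m) r, size r.2 = (d.+2 + m)%N &
    pequiv (d.+2 + m) (phi 'X^(d.+2) b q) r].
Proof.
move=> b0 pq.
(* V is the inverse of b + T X^(d+1) modulo X^(d+2), and U X^(d+2) cancels the remaining term - T^2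
   b^-2 X^(2d+2). *)
pose H2 : {poly {poly k}} := (b%:P)%:P + ('X)%:P * 'X^(d.+1).
pose V : {poly {poly k}} := ((b^-1)%:P)%:P - ('X * (b^-2)%:P)%:P * 'X^(d.+1).
pose U : {poly {poly k}} := ('X ^+ 2 * (b^-2)%:P)%:P * 'X^d.
have sC (c : {poly k}) e : (e <= d.+1)%N -> (size (c%:P * 'X^e)%R <= d.+2)%N.
  move=> le; rewrite mul_polyC (leq_trans (size_scale_leq _ _)) //.
  by rewrite size_polyXn ltnS.
have sCC (c : {poly k}) : (size c%:P <= d.+2)%N.
  exact: leq_trans (size_polyC_leq1 _) _.
have hH : sl2head d.+2 ('X^(d.+2)) H2 U V.
  split.
  - exact: monicXn.
  - by rewrite size_polyXn.
  - by rewrite (leq_trans (size_polyD _ _)) // geq_max sCC sC.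
  - split; first exact: sC.
    by rewrite (leq_trans (size_polyD _ _)) // geq_max size_polyN sCC sC.
  rewrite /U /V /H2 !polyCM -!exprVn !rmorphXn /=.
  have : (b%:P)%:P * ((b^-1)%:P)%:P = 1 :> {poly {poly k}} by rewrite -!polyCM mulfV.
  move: (b%:P)%:P ((b^-1)%:P)%:P ('X)%:P => c c' T e.
  rewrite !exprS.
  transitivity (c * c' + (1 - c * c') * c' * T * 'X * 'X^d); first by ring.
  by rewrite e; ring.
have /= := pequiv_head hH pq.
set r := mobius _ _ _ _ _; set r' := mobius _ _ _ _ _ => h.
exists r'; split.
- by apply: mobius_pointed pq; apply: sl2head_map.
- rewrite /r' /= /H2 /U !(rmorphD, rmorphM) /= !map_polyC /= !map_polyXn.
  rewrite /horner_eval hornerX !hornerC polyC1 !mul1r.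
  case: pq => mq sq sq2 _.
  have sXq : size ('X^(d.+1) * q.1) = (d.+2 + m)%N.
    by rewrite size_monicM ?monicXn ?monic_neq0 // size_polyXn sq addnS.
  rewrite mulrDl addrAC addrC size_polyDl sXq //.
  apply: leq_ltn_trans (size_polyD _ _) _; rewrite gtn_max; apply/andP; split.
    rewrite mul_polyC (leq_ltn_trans (size_scale_leq _ _)) // sq addSn ltnS.
    by rewrite addSn ltnS leq_addl.
  rewrite mul_polyC -scalerAl (leq_ltn_trans (size_scale_leq _ _)) //.
  rewrite (leq_ltn_trans (size_polyMleq _ _)) // size_polyXn addSn /= ltnS.
  by rewrite leqW // leq_add2l.
suff -> : phi 'X^(d.+2) b q = r by [].
rewrite phiE /r map_polyXn /H2 /U /V !(rmorphD, rmorphN, rmorphM) /=.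
rewrite !map_polyC /= !map_polyXn /horner_eval hornerX !hornerC polyC0.
by rewrite !(mul0r, addr0, oppr0).
Qed.

Lemma pequiv_cfrac n p : pointed n p ->
  exists u, [/\ nonzeros u, size u = n & pequiv n p (cfrac u)].
Proof.
elim/ltn_ind: n p => -[|n] IHn p pp.
  case: p pp => A B [/= mA sA sB _]; exists [::]; split=> //.
  have -> : B = 0 by apply/eqP; rewrite -size_poly_eq0 -leqn0.
  have := size1_polyC (eq_leq sA) => eA.
  suff -> : A = 1 by apply: pequiv_refl.
  by move: mA; rewrite monicE lead_coefE sA /= eA; rewrite coefC /= => /eqP ->.
(* With a denominator of degree n the quotient is linear and induction applies to the rest;
   [pequiv_raise] reduces the other case to this one. *)
have deg1 (r : {poly k} * {poly k}) : pointed n.+1 r -> size r.2 = n.+1 ->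
    exists u, [/\ nonzeros u, size u = n.+1 & pequiv n.+1 r (cfrac u)].
  move=> pr sr; have [d [m [P [b [q [[en mP sP b0 [pq er]] sr2]]]]]] := pointed_euclid pr.
  have em : m = n by move: sr; rewrite sr2 => -[].
  have ed : d = 0%N by move: en; rewrite em; lia.
  subst m d; have [u [nu su pu]] := IHn n (ltnSn n) q pq.
  exists (b :: u); split; rewrite /= ?b0 ?su // er.
  apply: pequiv_trans (pequiv_phi_Xn (d := 0) mP sP b0 pq) _.
  by apply: pequiv_phi pu; rewrite ?monicX ?size_polyX.
have [d [m [P [b [q [[en mP sP b0 [pq ep]] sp2]]]]]] := pointed_euclid pp.
case: d en sP => [|d] en sP; first by apply: deg1; rewrite ?sp2 // -en.
have [r [pr sr h]] := pequiv_raise d b0 pq.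
rewrite -en in pr sr h; have [u [nu su pu]] := deg1 r pr sr.
exists u; split=> //; rewrite ep; apply: pequiv_trans (pequiv_trans h pu).
by rewrite en; apply: pequiv_phi_Xn.
Qed.
End NormalForm.

(** * Bezout forms of continued fractions *)

Section BezoutInvariants.
Variable k : fieldType.
Implicit Types p q : {poly k} * {poly k}.

Lemma Un_homotopy_bez n (H1 H2 : {poly {poly k}}) : Un_point n H1 H2 ->
  let B t := BezR n (map_poly (horner_eval t) H1) (map_poly (horner_eval t) H2) in
  stcong (B 0) (B 1) /\ \det (B 0) = \det (B 1).
Proof.
case=> s1 s2 _ ures B; have uB := BezR_unit s1 s2 ures.
rewrite /B !BezR_map; split.
  by apply: homotopy_stcong; split; rewrite ?tr_BezR.
rewrite !det_map_mx /=; move: uB; rewrite unitmxE poly_unitE => /andP[/eqP/eq_leq/size1_polyC -> _].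
by rewrite /horner_eval !hornerC.
Qed.

Lemma pequiv_bez n p q : pequiv n p q ->
  stcong (BezR n p.1 p.2) (BezR n q.1 q.2) /\
  \det (BezR n p.1 p.2) = \det (BezR n q.1 q.2).
Proof.
elim=> {p q} [p q [H [pH [-> ->]]]|p|p q _ [h e]|p q r _ [h1 e1] _ [h2 e2]].
- exact: Un_homotopy_bez (pointed_Un pH).
- by split=> //; apply: stcong_refl.
- by split=> //; apply: stcong_sym.
- by split; [apply: stcong_trans h1 h2 | rewrite e1].
Qed.

Fixpoint diagform (u : seq k) : 'M[k]_(size u) :=
  if u is a :: u' return 'M[k]_(size u) then dsum (a%:M : 'M_1) (diagform u') else 1%:M.

Lemma symnd_diagform u : nonzeros u -> symnd (diagform u).
Proof.
elim: u => [_|a u IHu /= /andP[a0 nu]]; first exact: sy1.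
apply: (proj2 (@symnd_dsum k 1 (size u) a%:M (diagform u))); split; last exact: IHu.
by split; rewrite ?tr_scalar_mx // unitmxE det_scalar1 unitfE.
Qed.

(** The term with P = X contributes (X - Y) a A(X) A(Y); determinant 1 returns the old numerator
    unchanged. *)
Lemma bezq_phi (a : k) p : a != 0 ->
  bezq (phi 'X a p).1 (phi 'X a p).2 = p.1^:P * (a *: p.1)%:P + bezq p.1 p.2.
Proof.
move=> a0; apply/esym/bezq_unique; rewrite mulrDl bqE /phi /= -!mul_polyC.
rewrite !(rmorphM, rmorphB) /= map_polyX !map_polyC /=.
have : (a%:P)%:P * (a^-1%:P)%:P = 1 :> {poly {poly k}} by rewrite -!polyCM mulfV.
move: (a%:P)%:P (a^-1%:P)%:P => c c' e.
set A := p.1^:P; set A' := p.1%:P; set B := p.2^:P; set B' := p.2%:P.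
transitivity (('X - ('X)%:P) * (A * (c * A')) + (c * c') * (A * B' - A' * B)).
  by rewrite e; ring.
by ring.
Qed.

(** The form is a l^T l plus the old form in the first n coordinates, l being the coefficient row of
    p.1. Since p.1 is monic of degree n, these n + 1 linear forms have determinant 1 up to sign, so
    the determinant is multiplied by exactly a. *)
Lemma bez_phi n (a : k) p : a != 0 -> pointed n p ->
  exists P : 'M[k]_(1 + n), (\det P) ^+ 2 = 1 /\
    P^T *m dsum a%:M (BezR n p.1 p.2) *m P = BezR n.+1 (phi 'X a p).1 (phi 'X a p).2.
Proof.
move=> a0 [mp sp1 sp2 _].
pose r : 'M[k]_(1, 1 + n) := \row_j p.1`_j.
pose e : 'M[k]_(n, 1 + n) := \matrix_(i, j) (i == j :> nat)%:R.
exists (col_mx r e); split; last first.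
  rewrite tr_col_mx /dsum mul_row_block !mulmx0 addr0 add0r mul_row_col.
  apply/matrixP=> i j; rewrite !mxE bezq_phi // coefD coefMC coef_map /= coefD -/(_`_ _).
  rewrite coefCM coefZ; congr (_ + _).
    by rewrite big_ord1 !mxE big_ord1 !mxE eqxx mulr1n; ring.
  have bE (h l : nat) : (n <= h)%N || (n <= l)%N -> (bezq p.1 p.2)`_h`_l = 0.
    by apply: coef_bezq_ge; rewrite ?sp1 // leqW.
  have sumE (h : nat) (f : nat -> k) :
      \sum_(l < n) (l == h :> nat)%:R * f l = if (h < n)%N then f h else 0.
    case: ltnP => [lt|le].
      rewrite (bigD1 (Ordinal lt)) //= eqxx mul1r big1 ?addr0 // => l /negbTE nl.
      by rewrite -val_eqE /= in nl; rewrite nl mul0r.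
    by rewrite big1 // => l _; rewrite ltn_eqF ?mul0r // (leq_trans _ le).
  transitivity (\sum_(l < n) (l == j :> nat)%:R *
      (\sum_(h < n) (h == i :> nat)%:R * (bezq p.1 p.2)`_h`_l)).
    apply: eq_bigr => l _; rewrite !mxE mulrC; congr (_ * _).
    by apply: eq_bigr => h _; rewrite !mxE.
  rewrite (sumE j (fun l => \sum_(h < n) (h == i :> nat)%:R * (bezq p.1 p.2)`_h`_l)).
  rewrite (sumE i (fun h => (bezq p.1 p.2)`_h`_j)).
  by case: ltnP => le; [case: ltnP => // le' |]; rewrite bE // ?le ?le' ?orbT.
have M0 j : col_mx r e ord0 j = p.1`_j.
  transitivity (col_mx r e (lshift n ord0) j); last by rewrite col_mxEu mxE.
  by congr (col_mx _ _ _ _); apply: val_inj.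
have MS i j : col_mx r e (lift ord0 i) j = (i == j :> nat)%:R.
  transitivity (col_mx r e (rshift 1 i) j); last by rewrite col_mxEd mxE.
  by congr (col_mx _ _ _ _); apply: val_inj.
have -> : \det (col_mx r e) = (-1) ^+ n.
  rewrite (expand_det_col _ (ord_max : 'I_(1 + n))) big_ord_recl /= M0 big1.
    have -> : p.1`_(ord_max : 'I_(1 + n)) = 1.
      by move: mp; rewrite monicE lead_coefE sp1 => /eqP.
    rewrite addr0 mul1r /cofactor (_ : row' _ _ = 1%:M) ?det1 ?mulr1 //.
    by apply/matrixP=> i l; rewrite [LHS]mxE [LHS]mxE MS lift_max mxE -val_eqE.
  by move=> i _; rewrite MS /= ltn_eqF ?mul0r.
by rewrite sqrr_sign.
Qed.
End BezoutInvariants.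

(** * Classification of diagonal forms *)

Section Classification.
Variable k : fieldType.
Implicit Types (p q : {poly k} * {poly k}) (u v w : seq k).

Definition prodseq u := \prod_(a <- u) a.

Lemma cfrac_bez n u : nonzeros u -> size u = n ->
  cong (diagform u) (BezR n (cfrac u).1 (cfrac u).2) /\
  \det (BezR n (cfrac u).1 (cfrac u).2) = prodseq u.
Proof.
move=> + <-; elim: u => [_|a u IHu /= /andP[a0 nu]].
  by split; [apply: cong_size0 | rewrite det_mx00 /prodseq big_nil].
have [cu du] := IHu nu; have [P [dP eP]] := bez_phi a0 (pointed_cfrac nu).
rewrite /prodseq big_cons -[\prod_(_ <- _) _]/(prodseq u) -du; split; last first.
  rewrite -eP !det_mulmx det_tr mulrC mulrA -expr2 dP mul1r.
  have := det_dsum (a%:M : 'M[k]_1) (BezR (size u) (cfrac u).1 (cfrac u).2).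
  by rewrite det_scalar1.
apply: cong_trans (cong_dsum (cong_refl (a%:M : 'M_1)) cu) _.
rewrite -eP; apply: cong_unit; rewrite unitmxE unitfE.
by rewrite -sqrf_eq0 dP oner_eq0.
Qed.

Lemma pequiv_diagform u v : nonzeros u -> nonzeros v -> size u = size v ->
  pequiv (size u) (cfrac u) (cfrac v) ->
  stcong (diagform u) (diagform v) /\ prodseq u = prodseq v.
Proof.
move=> nu nv suv /pequiv_bez[h e]; have [cu du] := cfrac_bez nu erefl.
have [cv dv] := cfrac_bez nv (esym suv).
split; last by rewrite -du e.
by apply: stcong_trans (cong_stcong cu) (stcong_trans h (cong_stcong (cong_sym cv))).
Qed.

Lemma stcong_diagform_cons a u v : a != 0 ->
  stcong (diagform (a :: u)) (diagform (a :: v)) -> stcong (diagform u) (diagform v).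
Proof.
move=> a0 h.
have {}h : stcong (dsum (a%:M : 'M_1) (diagform u)) (dsum (a%:M : 'M_1) (diagform v)) := h.
have sa : symnd (a%:M : 'M[k]_1).
  by split; rewrite ?tr_scalar_mx // unitmxE det_scalar1 unitfE.
apply: (stcong_cancel sa (stcong_refl _)).
apply: stcong_trans (cong_stcong (cong_dsumC _ _)) _.
exact: stcong_trans h (cong_stcong (cong_dsumC _ _)).
Qed.

Definition qform u (x : 'cV[k]_(size u)) : k := (x^T *m diagform u *m x) 0 0.

Lemma dsum_quadratic m n r (b : 'M[k]_m) (c : 'M[k]_n) (x : 'M_(m, r)) (y : 'M_(n, r)) :
  (col_mx x y)^T *m dsum b c *m col_mx x y = x^T *m b *m x + y^T *m c *m y.
Proof.
by rewrite tr_col_mx /dsum mul_row_block !mulmx0 addr0 add0r mul_row_col.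
Qed.

Lemma qform_cons a u (x : 'M[k]_1) (y : 'cV[k]_(size u)) :
  @qform (a :: u) (col_mx x y) = a * x 0 0 ^+ 2 + qform y.
Proof.
have e := dsum_quadratic (a%:M : 'M_1) (diagform u) x y.
transitivity ((x^T *m (a%:M : 'M_1) *m x + y^T *m diagform u *m y) 0 0).
  by rewrite -e.
rewrite mxE; congr (_ + _).
by rewrite mul_mx_scalar -scalemxAl mxE mxE big_ord1 mxE.
Qed.

Definition splits_plane u := exists e f u',
  [/\ e != 0, f != 0, nonzeros u', size u = (size u').+2 &
  pequiv (size u) (cfrac u) (cfrac [:: e, - (f ^+ 2 / e) & u'])].

(** The square is needed already in rank one: the entry a takes the value a x^2, but homotopies fix
    the product of the entries. *)
Definition represents u c := exists t u', [/\ t != 0, nonzeros u', size u = (size u').+1 &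
  pequiv (size u) (cfrac u) (cfrac (c * t ^+ 2 :: u'))].

(** The value is built coordinate by coordinate: the tail y is turned into one entry, to which
    [pequiv_represent] adds the contribution of the head. The only obstruction is a zero value, and
    then the two entries involved are a plane. *)
Lemma represent u (x : 'cV[k]_(size u)) : nonzeros u ->
  [\/ x = 0, qform x != 0 /\ represents u (qform x) | splits_plane u].
Proof.
elim: u x => [|a u IHu] x; first by constructor 1; rewrite (flatmx0 x).
rewrite -(@vsubmxK k 1 (size u) 1 x).
move: (usubmx _) (dsubmx _) => {}x y /= /andP[a0 nu].
have nau : nonzeros (a :: u) by rewrite /= a0.
have xE : x = (x 0 0)%:M by rewrite -mx11_scalar.
rewrite qform_cons.
case: (IHu y nu) => [->|[q0 [t [u' [t0 nu' su hu]]]]|[e [f [u' [e0 f0 nu' su hu]]]]].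
- have -> : qform (0 : 'cV[k]_(size u)) = 0 by rewrite /qform mulmx0 mxE.
  rewrite addr0; have [x0|x0] := eqVneq (x 0 0) 0.
    by constructor 1; rewrite xE x0 raddf0 col_mx0.
  constructor 2; rewrite mulf_neq0 ?expf_neq0 //; split=> //.
  exists (x 0 0)^-1, u; rewrite invr_eq0 x0 nu; split=> //.
  by rewrite exprVn mulfK ?expf_neq0 //; apply: pequiv_refl.
- pose b := qform y * t ^+ 2; have b0 : b != 0 by rewrite mulf_neq0 ?expf_neq0.
  pose s := x 0 0 * t.
  have h1 : pequiv (size u).+1 (cfrac (a :: u)) (cfrac [:: a, b & u']) by apply: pequiv_cons.
  have eb : b + s ^+ 2 * a = (a * x 0 0 ^+ 2 + qform y) * t ^+ 2 by rewrite /b /s; ring.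
  have [c0|c0] := eqVneq (a * x 0 0 ^+ 2 + qform y) 0.
    have bE : b = - ((s * a) ^+ 2 / a).
      apply/eqP; rewrite -addr_eq0 -[X in _ == X](mul0r (t ^+ 2)) -c0 -eb.
      by apply/eqP; congr (_ + _); field.
    have s0 : s != 0 by apply: contraNneq b0 => s0; rewrite bE s0 mul0r expr0n mul0r oppr0.
    constructor 3; exists a, (s * a), u'; split=> //; first exact: mulf_neq0.
      by rewrite /= su.
    by rewrite -bE.
  have bs0 : b + s ^+ 2 * a != 0 by rewrite eb mulf_neq0 ?expf_neq0.
  constructor 2; split=> //; exists t, (a * b / (b + s ^+ 2 * a) :: u'); split=> //.
  - by rewrite /= nu' andbT !mulf_neq0 ?invr_eq0.
  - by rewrite /= su.
  apply: pequiv_trans h1 _; rewrite -eb [size _]/= su; exact: pequiv_represent.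
have g0 : - (f ^+ 2 / e) != 0 by rewrite oppr_eq0 mulf_neq0 ?invr_eq0 ?expf_neq0.
have h1 : pequiv (size u).+1 (cfrac (a :: u)) (cfrac [:: a, e, - (f ^+ 2 / e) & u']).
  exact: pequiv_cons.
constructor 3; exists e, f, (a :: u'); split=> //; first by rewrite /= a0.
  by rewrite /= su.
apply: pequiv_trans h1 _; rewrite [size _]/= su.
apply: pequiv_trans (_ : pequiv _ _ (cfrac [:: e, a, - (f ^+ 2 / e) & u'])) _.
  by apply: (@pequiv_swap _ _ _ (_ :: u')); rewrite //= g0.
apply: (@pequiv_cons _ _ [:: a, - (f ^+ 2 / e) & u']) => //.
exact: pequiv_swap.
Qed.

Lemma not_splits_plane_aniso u : nonzeros u -> ~ splits_plane u -> aniso (diagform u).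
Proof.
move=> nu nh x x0; case: (represent x nu) => // -[].
by rewrite /qform x0 mxE eqxx.
Qed.

Lemma prodseq_cons a u : prodseq (a :: u) = a * prodseq u.
Proof. exact: big_cons. Qed.

(* When neither form splits off a hyperbolic plane, diagform u is anisotropic, so that
   stable isometry with diagform v is isometry and diagform u represents the head of v. *)
Lemma diagform_classification u v : nonzeros u -> nonzeros v -> size u = size v ->
  stcong (diagform u) (diagform v) -> prodseq u = prodseq v ->
  pequiv (size u) (cfrac u) (cfrac v).
Proof.
have [n leu] := ubnP (size u); elim: n u v leu => // n IHn u v leu.
have tail c w w' : (size w < n)%N -> c != 0 -> nonzeros w -> nonzeros w' -> size w = size w' ->
    stcong (diagform (c :: w)) (diagform (c :: w')) -> prodseq (c :: w) = prodseq (c :: w') ->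
    pequiv (size w).+1 (cfrac (c :: w)) (cfrac (c :: w')).
  move=> lew c0 nw nw' sw /(stcong_diagform_cons c0) sim; rewrite !prodseq_cons => /(mulfI c0) e.
  by apply: pequiv_cons c0 _; apply: IHn.
suff main w w' : (size w < n.+1)%N -> nonzeros w -> nonzeros w' -> size w = size w' ->
    stcong (diagform w) (diagform w') -> prodseq w = prodseq w' -> ~ splits_plane w ->
    pequiv (size w) (cfrac w) (cfrac w').
  move=> nu nv suv sim euv.
  have [hu|hu] := classic (splits_plane u); last exact: main.
  have [hv|hv] := classic (splits_plane v); last first.
    by rewrite suv; apply/pequiv_sym/main => //; [rewrite -suv | apply: stcong_sym].
  (* Changing e into 1 gives both sides the same head. Only this entry is cancelled, and the
     induction takes the rest. *)
  have norm w : nonzeros w -> splits_plane w -> exists f w',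
      [/\ f != 0, nonzeros w', size w = (size w').+2 &
      pequiv (size w) (cfrac w) (cfrac [:: 1, f & w'])].
    move=> nw [e [f [w' [e0 f0 nw' sw hw]]]]; exists (- (f ^+ 2 / 1)), w'.
    rewrite oppr_eq0 divr1 expf_neq0 //; split=> //; apply: pequiv_trans hw _.
    by rewrite sw -[f ^+ 2 in X in pequiv _ _ X]divr1; apply: pequiv_splits_plane; rewrite ?oner_neq0.
  have [f [u' [f0 nu' su hu']]] := norm u nu hu.
  have [f' [v' [f'0 nv' sv hv']]] := norm v nv hv.
  have n1 : nonzeros [:: 1, f & u'] by rewrite /= oner_neq0 f0.
  have n1' : nonzeros [:: 1, f' & v'] by rewrite /= oner_neq0 f'0.
  have [simu eu] := pequiv_diagform nu n1 su hu'.
  have [simv ev] := pequiv_diagform nv n1' sv hv'.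
  apply: pequiv_trans hu' _; rewrite suv; apply: pequiv_trans _ (pequiv_sym hv').
  have suv' : size u' = size v' by move: suv; rewrite su sv => -[].
  rewrite sv -suv'; apply: (tail 1 (f :: u') (f' :: v')) => //=; rewrite ?oner_neq0 ?f0 ?f'0 ?suv' //.
  - by move: leu; rewrite su suv'; lia.
  - exact: stcong_trans (stcong_sym simu) (stcong_trans sim simv).
  - by rewrite -eu -ev.
move=> lew nw nw' sw sim ew nh; have anw := not_splits_plane_aniso nw nh.
case: w' nw' sw sim ew => [|c w'] nw' sw sim ew.
  by have -> : w = [::] by [case: (w) sw]; apply: pequiv_refl.
have cw := aniso_stcong_cong anw (symnd_diagform nw') sim.
have /= /andP[c0 nw'1] := nw'.
case: cw => P [Q [PQ QP Pw]].
pose d : 'cV[k]_(1 + size w') := col_mx 1%:M 0.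
have qP : qform (P *m d) = c.
  transitivity (@qform (c :: w') d); last first.
    by rewrite qform_cons mxE expr1n mulr1 /qform mulmx0 mxE addr0.
  by rewrite /qform -Pw trmx_mul !mulmxA.
case: (represent (P *m d) nw) => [e|[_]|//].
  by move: c0; rewrite -qP e /qform mulmx0 mxE eqxx.
rewrite qP => -[t [w1 [t0 nw1 sw1 hw1]]].
have ct0 : c * t ^+ 2 != 0 by rewrite mulf_neq0 ?expf_neq0.
have nw1' : nonzeros (c * t ^+ 2 :: w1) by rewrite /= ct0.
have [sim1 e1] := pequiv_diagform nw nw1' sw1 hw1.
have {}sim1 := stcong_trans (stcong_sym sim1) sim; rewrite ew prodseq_cons in e1.
apply: pequiv_trans hw1 _.
have sw11 : size w1 = size w' by move: sw; rewrite sw1 => -[].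
(* The head is c only up to t^2. In rank one equal products force t^2 = 1; otherwise the square is
   passed to the next entry. *)
rewrite sw1; case: w1 nw1 sw1 ct0 nw1' sim1 e1 sw11 => [|b w1] nw1 sw1 ct0 nw1' sim1 e1 sw11.
  case: (w') sw11 e1 => // _; rewrite /prodseq big_seq1 big_nil mulr1 => <-; exact: pequiv_refl.
have /= /andP[b0 nw2] := nw1.
have h := pequiv_move_square c0 b0 t0 nw2.
apply: (pequiv_trans h).
have nbt : nonzeros (b * t ^+ 2 :: w1) by rewrite /= mulf_neq0 ?expf_neq0.
have [sim2 e2] : stcong (diagform [:: c * t ^+ 2, b & w1]) (diagform [:: c, b * t ^+ 2 & w1]) /\
    prodseq [:: c * t ^+ 2, b & w1] = prodseq [:: c, b * t ^+ 2 & w1].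
  apply: pequiv_diagform; [exact: nw1' | by rewrite /= c0 | by [] | exact: h].
apply: (tail c (b * t ^+ 2 :: w1) w') => //.
- by move: lew; rewrite sw1 /=; lia.
- exact: stcong_trans (stcong_sym sim2) sim1.
by rewrite -e2 -e1 prodseq_cons.
Qed.
End Classification.

(** * Unpointed pairs *)

Section UnPoints.
Variable R : idomainType.
Implicit Types A B : {poly R}.

Lemma Un_swap n A B : Un_point n A B -> Un_point n B A.
Proof.
case=> sA sB [u [v uv]] ures; split=> //.
  by exists v, u; rewrite -uv; apply: eq_bigr => i _; rewrite addrC.
apply: spans_res => j /(res_spans sA sB ures)[U [V [sU sV e]]].
by exists V, U; rewrite addrC.
Qed.

Lemma Un_shear1 n A B (c : R) : Un_point n A B -> Un_point n (A + c *: B) B.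
Proof.
case=> sA sB [u [v uv]] ures; split=> //.
- by rewrite (leq_trans (size_polyD _ _)) // geq_max sA (leq_trans (size_scale_leq _ _)).
- exists u, (fun i => v i - u i * c); rewrite -uv; apply: eq_bigr => i _.
  by rewrite coefD coefZ; ring.
apply: spans_res => j /(res_spans sA sB ures)[U [V [sU sV e]]].
exists U, (V - c *: U); rewrite -e -!mul_polyC; split=> //; last by ring.
rewrite (leq_trans (size_polyD _ _)) // geq_max sV size_polyN mul_polyC.
by rewrite (leq_trans (size_scale_leq _ _)).
Qed.

Lemma Un_shear2 n A B (c : R) : Un_point n A B -> Un_point n A (B + c *: A).
Proof. by move/Un_swap/(Un_shear1 c)/Un_swap. Qed.

Lemma Un_scale n A B (c : R) : c \is a GRing.unit ->
  Un_point n A B -> Un_point n (c *: A) (c *: B).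
Proof.
move=> uc [sA sB [u [v uv]] ures]; split.
- exact: leq_trans (size_scale_leq _ _) sA.
- exact: leq_trans (size_scale_leq _ _) sB.
- exists (fun i => u i * c^-1), (fun i => v i * c^-1).
  by rewrite -uv; apply: eq_bigr => i _; rewrite !coefZ !mulrA !mulrVK.
apply: spans_res => j /(res_spans sA sB ures)[U [V [sU sV e]]].
exists (c^-1 *: U), (c^-1 *: V); split.
- exact: leq_trans (size_scale_leq _ _) sU.
- exact: leq_trans (size_scale_leq _ _) sV.
by rewrite -!scalerAl -!scalerAr !scalerA mulVr // !scale1r.
Qed.

(** If both top coefficients vanish, X^(2n-1) is not reached. For n = 0 the resultant is an empty
    determinant, and unimodularity excludes the zero pair. *)
Lemma Un_top n A B : Un_point n A B -> (A`_n != 0) || (B`_n != 0).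
Proof.
case=> sA sB [u [v uv]] ures; rewrite -negb_and; apply/negP=> /andP[/eqP A0 /eqP B0].
case: n sA sB uv ures A0 B0 => [|n] sA sB uv ures A0 B0.
  move/eqP: uv; rewrite big_ord1 A0 B0 !mulr0 addr0 eq_sym; exact/negP/oner_neq0.
have [|U [V [sU sV]]] := res_spans sA sB ures (_ : n.+1 + n < n.+1 + n.+1)%N.
  by rewrite ltn_add2l.
have sz (C D : {poly R}) : (size C <= n.+1)%N -> (size D <= n.+2)%N -> D`_n.+1 = 0 ->
    (size (C * D)%R <= n.+1 + n)%N.
  move=> sC sD D0; have sD' : (size D <= n.+1)%N.
    by apply/leq_sizeP=> j; rewrite leq_eqVlt => /predU1P[<- //|lt]; rewrite nth_default // (leq_trans sD).
  rewrite (leq_trans (size_polyMleq _ _)) // -subn1 leq_subLR add1n -addnS.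
  exact: leq_add.
move/(congr1 (fun p : {poly R} => size p)); rewrite /= size_polyXn => e.
have : (size (U * A + V * B)%R <= n.+1 + n)%N.
  by rewrite (leq_trans (size_polyD _ _)) // geq_max !sz.
by rewrite e ltnn.
Qed.
End UnPoints.

(** * Unpointed homotopies, their invariants, and diagonalization *)

Section Naive.
Variable k : fieldType.
Implicit Types (A B : {poly k}) (p q : {poly k} * {poly k}).

Lemma naive_trans n p q r : naive_equiv n p q -> naive_equiv n q r -> naive_equiv n p r.
Proof. exact: rst_trans. Qed.

Lemma naive_sym n p q : naive_equiv n p q -> naive_equiv n q p.
Proof. exact: rst_sym. Qed.

Lemma evTE (t : k) H : evT t H = map_poly (horner_eval t) H.
Proof. by []. Qed.

Lemma naive_shear1 n A B c : Un_point n A B -> naive_equiv n (A, B) (A + c *: B, B).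
Proof.
move=> AB; apply: rst_step; right.
exists (A^:P + (c *: 'X) *: B^:P), B^:P; split.
  exact: Un_shear1 (Un_point_map (polyC : {rmorphism k -> {poly k}}) AB).
have ev t : evT t (A^:P + (c *: 'X) *: B^:P) = A + (c * t) *: B.
  rewrite evTE rmorphD /= -[_ *: B^:P]mul_polyC rmorphM /= map_polyC /=.
  by rewrite !map_horner_cst /horner_eval hornerZ hornerX mul_polyC.
rewrite !ev mulr0 scale0r addr0 mulr1.
by rewrite !evTE !map_horner_cst.
Qed.

Lemma naive_shear2 n A B c : Un_point n A B -> naive_equiv n (A, B) (A, B + c *: A).
Proof.
move=> AB; apply: rst_step; right.
exists A^:P, (B^:P + (c *: 'X) *: A^:P); split.
  exact: Un_shear2 (Un_point_map (polyC : {rmorphism k -> {poly k}}) AB).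
have ev t : evT t (B^:P + (c *: 'X) *: A^:P) = B + (c * t) *: A.
  rewrite evTE rmorphD /= -[_ *: A^:P]mul_polyC rmorphM /= map_polyC /=.
  by rewrite !map_horner_cst /horner_eval hornerZ hornerX mul_polyC.
rewrite !ev mulr0 scale0r addr0 mulr1.
by rewrite !evTE !map_horner_cst.
Qed.

Lemma naive_weyl n A B s : s != 0 -> Un_point n A B ->
  naive_equiv n (A, B) (s *: B, - s^-1 *: A) /\ Un_point n (s *: B) (- s^-1 *: A).
Proof.
move=> s0 u0; have u1 := Un_shear1 s u0; have u2 := Un_shear2 (- s^-1) u1.
have u3 := Un_shear1 s u2.
have e2 : B + - s^-1 *: (A + s *: B) = - s^-1 *: A.
  by rewrite scalerDr scalerA mulNr mulVf // scaleN1r addrCA subrr addr0.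
have e1 : A + s *: B + s *: (- s^-1 *: A) = s *: B.
  by rewrite scalerA mulrN mulfV // scaleN1r addrAC subrr add0r.
rewrite e2 e1 in u3; split=> //.
apply: naive_trans (naive_shear1 s u0) _.
apply: naive_trans (naive_shear2 (- s^-1) u1) _; rewrite e2 in u2 *.
by apply: naive_trans (naive_shear1 s u2) _; rewrite e1; apply: rst_refl.
Qed.

(** The product of the Weyl elements for 1 and - a. *)
Lemma naive_diag n A B a : a != 0 -> Un_point n A B ->
  naive_equiv n (A, B) (a *: A, a^-1 *: B) /\ Un_point n (a *: A) (a^-1 *: B).
Proof.
move=> a0 /(naive_weyl (oner_neq0 k))[h u1].
have a0' : - a != 0 by rewrite oppr_eq0.
have [h' u2] := naive_weyl a0' u1.
have e1 : - a *: (- 1^-1 *: A) = a *: A by rewrite invr1 scalerA mulrN1 opprK.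
have e2 : - (- a)^-1 *: (1 *: B) = a^-1 *: B by rewrite invrN opprK scale1r.
by rewrite e1 e2 in h' u2; split=> //; apply: naive_trans h h'.
Qed.

Lemma naive_pointed n A B : Un_point n A B -> exists p, pointed n p /\ naive_equiv n (A, B) p.
Proof.
move=> AB; have [A1 [h1 u1 nz]] : exists A1,
    [/\ naive_equiv n (A, B) (A1, B), Un_point n A1 B & A1`_n != 0].
  have [A0|nzA] := eqVneq A`_n 0; last by exists A; split=> //; apply: rst_refl.
  exists (A + 1 *: B); split; [exact: naive_shear1 | exact: Un_shear1 |].
  by have := Un_top AB; rewrite A0 eqxx /= coefD coefZ A0 add0r mul1r.
pose c := - (B`_n / A1`_n); pose B1 := B + c *: A1.
have h2 := naive_shear2 c u1; have u2 := Un_shear2 c u1; rewrite -/B1 in h2 u2.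
have B10 : B1`_n = 0 by rewrite coefD coefZ /c mulNr divfK // subrr.
have nzV : (A1`_n)^-1 != 0 by rewrite invr_eq0.
have [h3 u3] := naive_diag nzV u2.
set A2 := (A1`_n)^-1 *: A1 in h3 u3; set B2 := _ *: B1 in h3 u3.
exists (A2, B2); split; last exact: naive_trans h1 (naive_trans h2 h3).
have A2n : A2`_n = 1 by rewrite coefZ mulVf.
have B2n : B2`_n = 0 by rewrite coefZ B10 mulr0.
case: u3 => sA sB uv ures.
have sA2 : size A2 = n.+1.
  apply/eqP; rewrite eqn_leq sA ltnNge; apply/negP=> le.
  by move/eqP: A2n; rewrite nth_default // eq_sym oner_eq0.
have sB2 : (size B2 <= n)%N.
  by apply/leq_sizeP=> j; rewrite leq_eqVlt => /predU1P[<- //|lt]; rewrite nth_default // (leq_trans sB).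
split=> //=; first by rewrite monicE lead_coefE sA2 A2n.
have [n0|n0] := posnP n.
  exists 1, 0; rewrite mul0r addr0 mul1r; rewrite n0 in sA2 A2n.
  by rewrite (size1_polyC (eq_leq sA2)) A2n.
have [|U [V [_ _ e]]] := res_spans sA sB ures (_ : 0 < n + n)%N.
  by rewrite addn_gt0 n0.
by exists U, V.
Qed.

Lemma naive_cfrac n A B : Un_point n A B ->
  exists u, [/\ nonzeros u, size u = n & naive_equiv n (A, B) (cfrac u)].
Proof.
move=> /naive_pointed[p [pp h]]; have [u [nu su hu]] := pequiv_cfrac pp.
by exists u; split=> //; apply: naive_trans h (pequiv_naive hu).
Qed.

Lemma cfrac_scale (s : k) u : s != 0 ->
  cfrac (map ( *%R s) u) = ((cfrac u).1, s *: (cfrac u).2).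
Proof.
move=> s0; elim: u => [|a u IHu] /=; first by rewrite scaler0.
by rewrite IHu /phi /= !scalerA invfM mulrAC mulVf ?mul1r.
Qed.

(** Rescaling by t gives (t A, t B), and the diagonal element of t^-1 turns it into (A, t^2 B),
    where every u_i is multiplied by t^2. This realises the factors t^(2n) of the determinant. *)
Lemma naive_scale n u (t : k) : t != 0 -> nonzeros u -> size u = n ->
  naive_equiv n (cfrac u) (cfrac (map ( *%R (t ^+ 2)) u)).
Proof.
move=> t0 nu su; have U := pointed_Un (pointed_cfrac nu); rewrite su in U.
rewrite cfrac_scale ?expf_neq0 //.
apply: (@naive_trans _ _ (t *: (cfrac u).1, t *: (cfrac u).2)).
  by apply: rst_step; left; exists t.
have [] := @naive_diag n (t *: (cfrac u).1) (t *: (cfrac u).2) t^-1.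
- by rewrite invr_eq0.
- by apply: Un_scale; rewrite ?unitfE.
by move=> + _; rewrite !scalerA mulVf // scale1r invrK expr2.
Qed.

Lemma prodseq_scale (s : k) u : prodseq (map ( *%R s) u) = s ^+ size u * prodseq u.
Proof.
elim: u => [|a u IHu] /=; first by rewrite /prodseq !big_nil mulr1.
by rewrite !prodseq_cons IHu exprS; ring.
Qed.

Lemma Un_unscale n A B (c : k) : c != 0 -> Un_point n (c *: A) (c *: B) -> Un_point n A B.
Proof.
move=> c0 /(@Un_scale _ _ _ _ c^-1); rewrite unitfE invr_eq0 => /(_ c0).
by rewrite !scalerA mulVf // !scale1r.
Qed.

(** Rescaling steps do not ask for points of U_n, so that property is carried along the chain with
    the invariants. *)
Lemma naive_bez n p q : naive_equiv n p q ->
  (Un_point n p.1 p.2 <-> Un_point n q.1 q.2) /\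
  (Un_point n p.1 p.2 -> stcong (BezR n p.1 p.2) (BezR n q.1 q.2) /\
   exists2 c, c != 0 & \det (BezR n p.1 p.2) = \det (BezR n q.1 q.2) * c ^+ (2 * n)).
Proof.
elim=> {p q} [p q|p|p q _ [U h]|p q r _ [U1 h1] _ [U2 h2]].
- case=> [[c [c0 ->]]|[H1 [H2 [UH [-> ->]]]]]; last first.
    split; first by split=> _; apply: (@Un_point_map _ _ (horner_eval _)) UH.
    move=> _; have [s e] := Un_homotopy_bez UH; split; first exact: s.
    by exists 1; rewrite ?oner_neq0 // expr1n mulr1; apply: e.
  have uc : c \is a GRing.unit by rewrite unitfE.
  split; first by split; [apply: Un_scale | apply: Un_unscale].
  have eB : BezR n (c *: p.1) (c *: p.2) = c ^+ 2 *: BezR n p.1 p.2.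
    by apply/matrixP=> i j; rewrite !mxE bqZ !coefCM.
  rewrite /= eB detZ; split.
    apply: cong_stcong.
    have -> : c ^+ 2 *: BezR n p.1 p.2 = (c%:M)^T *m BezR n p.1 p.2 *m c%:M.
      by rewrite tr_scalar_mx mul_scalar_mx mul_mx_scalar scalerA.
    by apply: cong_unit; rewrite unitmxE det_scalar unitrX.
  exists c^-1; first by rewrite invr_eq0.
  by rewrite exprM exprVn mulrAC exprVn mulfV ?mul1r // !expf_neq0.
- by split=> // _; split; [apply: stcong_refl | exists 1; rewrite ?oner_neq0 // expr1n mulr1].
- split; first by split=> /U.
  move=> /U Up; have [s [c c0 e]] := h Up; split; first exact: stcong_sym.
  exists c^-1; first by rewrite invr_eq0.
  by rewrite e exprVn mulfK // expf_neq0.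
split; first by split=> [/U1/U2|/U2/U1].
move=> Up; have [s1 [c1 c10 e1]] := h1 Up; have [s2 [c2 c20 e2]] := h2 (proj1 U1 Up).
split; first exact: stcong_trans s1 s2.
by exists (c2 * c1); rewrite ?mulf_neq0 // e1 e2 exprMn mulrA.
Qed.

Lemma stably_isoP n (b b' : 'M[k]_n) : stably_iso b b' <-> stcong b b'.
Proof.
split=> [[m [c [[sc uc] [P [uP e]]]]]|[m [c [[sc uc] [P [Q [PQ QP e]]]]]]].
  by exists m, c; split=> //; exists P, (invmx P); rewrite mulmxV ?mulVmx.
exists m, c; split=> //; exists P; split=> //.
by have [] := mulmx1_unit PQ.
Qed.

Lemma stcong_det n (b b' : 'M[k]_n) : stcong b b' ->
  exists2 r, r != 0 & \det b' = \det b * r ^+ 2.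
Proof.
case=> m [c [[_ uc] [P [Q [PQ QP e]]]]]; have [uP _] := mulmx1_unit PQ.
exists (\det P); first by rewrite -unitfE -unitmxE.
have c0 : \det c != 0 by rewrite -unitfE -unitmxE.
apply: (mulIf c0); rewrite -det_dsum -e !det_mulmx det_tr det_dsum expr2; ring.
Qed.

(** Alternating forms in characteristic 2 have no orthogonal basis, but stably a plane [0 1; 1 s]
    may be replaced by [metab 1], that is by <1, -1>. *)
Lemma diagonalize n (b : 'M[k]_n) : symnd b ->
  exists u, [/\ nonzeros u, size u = n & stcong b (diagform u)].
Proof.
have [N leN] := ubnP n; elim: N n leN b => // N IHN [|n] leN b sb.
  by exists [::]; split=> //; apply/cong_stcong/cong_size0.
rewrite -[n.+1]/(1 + n)%N in b sb *.
have eul : ulsubmx b = (b 0 0)%:M.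
  by rewrite [ulsubmx b]mx11_scalar !mxE !lshift0.
have [b0|b0] := eqVneq (b 0 0) 0; last first.
  have sul : symnd (ulsubmx b).
    by rewrite eul; split; rewrite ?tr_scalar_mx // unitmxE det_scalar1 unitfE.
  have eb : b = block_mx (ulsubmx b) (ursubmx b) (ursubmx b)^T (drsubmx b).
    by rewrite trmx_ursub sb.1 submxK.
  have := cong_schur (ursubmx b) (drsubmx b) sul; rewrite -eb.
  set b' := (_ - _) => cb; have [_ sb'] := proj1 (symnd_dsum _ _) (symnd_cong cb sb).
  have [u [nu su hu]] := IHN n leN b' sb'.
  exists (b 0 0 :: u); split; rewrite /= ?b0 ?su //.
  apply: stcong_trans (cong_stcong cb) _; rewrite eul.
  exact: stcong_dsum (stcong_refl _) hu.
pose v : 'cV[k]_(1 + n) := delta_mx 0 0.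
have v0 : v != 0.
  by apply/eqP=> /matrixP/(_ 0 0)/eqP; rewrite !mxE eqxx oner_eq0.
have vbv : v^T *m b *m v = 0.
  by rewrite trmx_delta -rowE -colE; apply/matrixP=> i j; rewrite !mxE b0.
have [m [P [Q [x [y [PQ QP ex _ [sx _]]]]]]] :=
  isotropic_split sb (trmx0 _ _ _) v0 (mul0mx _ v) vbv.
have cb : cong b (hsplit x) by exists P, Q.
have en := inv_size PQ QP.
have {}cb := cong_trans cb (cong_hsplit sx).
have [_ sdr] := proj1 (symnd_dsum _ _) (symnd_cong cb sb).
have ltm : (m < N)%N by move: leN; rewrite -[n.+1]/(1 + n)%N en; lia.
have [u [nu su hu]] := IHN m ltm (drsubmx x) sdr.
exists [:: 1, -1 & u]; split.
- by rewrite /= oppr_eq0 oner_eq0.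
- by rewrite /= su en.
apply: stcong_trans (cong_stcong cb) _.
apply: stcong_trans (stcong_dsum (_ : stcong _ (dsum (1%:M : 'M[k]_1) (- 1%:M : 'M[k]_1))) hu) _.
  apply: stcong_trans (cong_stcong (cong_metab_dsum (sy1 k 1))).
  by apply: stcong_metab; rewrite ?trmx1 // trmx_ulsub sx.
have -> : (- 1%:M : 'M[k]_1) = (-1)%:M by rewrite raddfN.
exact: cong_stcong (cong_sym (cong_dsumA _ _ _)).
Qed.
End Naive.

(* For each degree n, the map on the degree-n components is well defined
   (lands in the target, respects the equivalences), injective and surjective;
   this is bijectivity of the graded map. *)
Theorem theorem4p3 (k : fieldType) (n : nat) :
  (forall A B : {poly k}, Un_point n A B ->
     fib_elem (Bez n A B) (\det (Bez n A B))) /\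
  (forall A B A' B' : {poly k}, Un_point n A B -> Un_point n A' B' ->
     naive_equiv n (A, B) (A', B') ->
     fib_equiv (bez_map n A B) (bez_map n A' B')) /\
  (forall A B A' B' : {poly k}, Un_point n A B -> Un_point n A' B' ->
     fib_equiv (bez_map n A B) (bez_map n A' B') ->
     naive_equiv n (A, B) (A', B')) /\
  (forall (b : 'M[k]_n) (d : k), fib_elem b d ->
     exists A B : {poly k}, Un_point n A B /\
       fib_equiv (bez_map n A B) (b, d)).
Proof.
have syB A B : Un_point n A B -> symnd (BezR n A B).
  by case=> sA sB _ ures; split; [apply: tr_BezR | apply: BezR_unit].
split; last split; last split.
- move=> A B /syB sB; split; first exact: sB.
    by rewrite -unitfE -unitmxE; case: sB.
  by exists 1; rewrite oner_neq0 expr1n mulr1.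
- move=> A B A' B' U U' /naive_bez[_ /(_ U)[h [c c0 e]]]; split; last by right; exists c.
  exact/stably_isoP.
- move=> A B A' B' U U' [/stably_isoP sim det2n].
  have [u [nu su hu]] := naive_cfrac U; have [v [nv sv hv]] := naive_cfrac U'.
  have [_ /(_ U)[simu [c c0 eu]]] := naive_bez hu.
  have [_ /(_ U')[simv [c' c'0 ev]]] := naive_bez hv.
  apply: naive_trans hu (naive_trans _ (naive_sym hv)).
  have [cu du] := cfrac_bez nu su; have [cv dv] := cfrac_bez nv sv.
  have simuv : stcong (diagform u) (diagform v).
    apply: stcong_trans (cong_stcong cu) _; apply: stcong_trans (stcong_sym simu) _.
    by apply: stcong_trans sim _; apply: stcong_trans simv (cong_stcong (cong_sym cv)).
  have [t t0 et] : exists2 t, t != 0 & prodseq u = prodseq v * t ^+ (2 * n).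
    case: det2n => [n0|[r [r0 er]]].
      exists 1; rewrite ?oner_neq0 // expr1n mulr1.
      by move: su sv; rewrite n0 => /size0nil -> /size0nil ->.
    exists (r * c' / c); first by rewrite !mulf_neq0 ?invr_eq0.
    have {}er : \det (BezR n A B) = \det (BezR n A' B') * r ^+ (2 * n) := er.
    have cn0 : c ^+ (2 * n) != 0 by rewrite expf_neq0.
    apply: (mulIf cn0); rewrite -du -dv -eu /= er ev.
    by rewrite !exprMn exprVn -!mulrA mulVf // mulr1 [r ^+ _ * _]mulrC.
  (* Multiplying the entries of v by t^2 multiplies their product by t^(2n), which makes it equal to
     that of u. *)
  have nv' : nonzeros (map ( *%R (t ^+ 2)) v).
    rewrite /nonzeros all_map; apply: sub_all nv => a a0 /=.
    by rewrite mulf_neq0 ?expf_neq0.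
  have sv' : size (map ( *%R (t ^+ 2)) v) = n by rewrite size_map.
  have hv' := naive_scale t0 nv sv.
  have UV : Un_point n (cfrac v).1 (cfrac v).2 by have := pointed_Un (pointed_cfrac nv); rewrite sv.
  have [_ /(_ UV)[sv1 _]] := naive_bez hv'.
  have [cv' _] := cfrac_bez nv' sv'.
  apply: naive_trans _ (naive_sym hv'); apply: pequiv_naive; rewrite -su.
  apply: diagform_classification; rewrite ?su ?sv' //.
    apply: stcong_trans simuv _; apply: stcong_trans (cong_stcong cv) _.
    exact: stcong_trans sv1 (cong_stcong (cong_sym cv')).
  by rewrite prodseq_scale sv -exprM et mulrC.
move=> b d [sb d0 [s [s0 edb]]].
have [u [nu su hu]] := diagonalize sb; have [cu du] := cfrac_bez nu su.
have sbu := stcong_trans hu (cong_stcong cu).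
have [r r0 er] := stcong_det sbu; rewrite du edb in er.
(* For n = 0 no entry can be adjusted, and the convention in [pow2n_equiv] settles the second
   coordinate. *)
case: u nu su hu cu du sbu er => [|a u] nu su hu cu du sbu er.
  exists (cfrac [::]).1, (cfrac [::]).2; split; first by rewrite -su; apply/pointed_Un/pointed_cfrac.
  by split; [apply/stably_isoP/stcong_sym | left].
(* The product of the entries is d (s r)^2; dividing the head by this square makes it d within the
   same stable class. *)
have /= /andP[a0 nu'] := nu; pose a' := a * (s * r)^-1 ^+ 2.
have a'0 : a' != 0 by rewrite mulf_neq0 // expf_neq0 // invr_eq0 mulf_neq0.
have nua : nonzeros (a' :: u) by rewrite /= a'0.
have [ca da] := cfrac_bez nua (su : size (a' :: u) = n).
exists (cfrac (a' :: u)).1, (cfrac (a' :: u)).2; split.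
  by have := pointed_Un (pointed_cfrac nua); rewrite [size _]su.
split.
  apply/stably_isoP/stcong_sym; apply: stcong_trans hu _.
  apply: stcong_trans (cong_stcong ca).
  have aa' : stcong (a%:M : 'M[k]_1) (a'%:M : 'M_1).
    apply: cong_stcong; pose c := (s * r)^-1.
    have -> : (a'%:M : 'M[k]_1) = (c%:M)^T *m a%:M *m c%:M.
      rewrite tr_scalar_mx -!scalar_mxM /a' -/c; congr (_%:M); ring.
    by apply: cong_unit; rewrite unitmxE det_scalar1 unitfE invr_eq0 mulf_neq0.
  exact: stcong_dsum aa' (stcong_refl (diagform u)).
right; exists 1; rewrite oner_neq0 expr1n mulr1; split=> //.
rewrite /= [LHS]da prodseq_cons /a'; move: er; rewrite prodseq_cons => er.
by rewrite mulrAC er; field; rewrite s0 r0.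
Qed.
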